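(* Let $\phi:\mathbb R\to\mathbb R$ satisfy $\phi\in C^2(\mathbb R)$, $\phi(0)=0$ and $0<\delta_1\le\phi'(s)\le\delta_2$ for all $s\in\mathbb R$, where $\delta_1,\delta_2$ are positive constants. Let $T>0$ and let $\Omega$ be a domain in $\mathbb R^N$, with $N\ge2$, where $\partial\Omega$ is not necessarily bounded. Assume that $u,v\in C^{2,1}(\Omega\times(0,T])\cap L^\infty(\Omega\times(0,T])\cap C^0(\overline\Omega\times(0,T])$ satisfy: $$\partial_tu-\Delta\phi(u)\le\partial_tv-\Delta\phi(v)\quad\text{in }\Omega\times(0,T],$$ $$u\le v\quad\text{on }\partial\Omega\times(0,T],$$ $$u(\cdot,t)\to u_0(\cdot)\ \text{ and }\ v(\cdot,t)\to v_0(\cdot)\quad\text{in }L^1_{loc}(\Omega)\text{ as }t\downarrow0,$$ where $u_0,v_0\in L^\infty(\Omega)$ satisfy $u_0\le v_0$ in $\Omega$. Then $u\le v$ in $\Omega\times(0,T]$.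
   Context: $C^{2,1}$ means twice continuously differentiable in $x$ and once in $t$. A domain is a nonempty connected open set; no regularity of $\partial\Omega$ is assumed. The case $\Omega=\mathbb R^N$ is allowed, in which case the boundary inequality is void. The inequality $u_0\le v_0$ is understood almost everywhere. *)

(* Defs.v *)
From HB Require Import structures.
From mathcomp Require Import all_boot all_order all_algebra.
From mathcomp Require Import all_classical all_reals all_analysis.

Set Implicit Arguments.
Unset Strict Implicit.
Unset Printing Implicit Defensive.
Import Order.TTheory GRing.Theory Num.Theory.
Import numFieldNormedType.Exports.
Local Open Scope classical_set_scope.
Local Open Scope ring_scope.

Definition rV_display : measure_display -> measure_display.
Proof. exact. Qed.

(* The coordinate projections generate the product sigma-algebra on row
   vectors, which for finitely many real coordinates is the Borel one. *)
Section measurable_rV.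
Context {R : realType} (n : nat).

Definition rV_coord (i : 'I_n) (x : 'rV[R]_n) : measurableTypeR R := x ord0 i.

Let rV_set0 : g_sigma_preimage rV_coord set0.
Proof. exact: sigma_algebra0. Qed.

Let rV_setC A : g_sigma_preimage rV_coord A -> g_sigma_preimage rV_coord (~` A).
Proof. exact: sigma_algebraC. Qed.

Let rV_bigcup (F : _^nat) : (forall i, g_sigma_preimage rV_coord (F i)) ->
  g_sigma_preimage rV_coord (\bigcup_i (F i)).
Proof. exact: sigma_algebra_bigcup. Qed.

HB.instance Definition _ := @isMeasurable.Build
  (rV_display default_measure_display) 'rV[R]_n
  (g_sigma_preimage rV_coord) rV_set0 rV_setC rV_bigcup.

Lemma measurable_rV_coord (i : 'I_n) :
  measurable_fun [set: 'rV[R]_n] (rV_coord i).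
Proof.
move=> _ Y mY; rewrite setTI; apply: sub_sigma_algebra => /=.
rewrite -bigcup_seq/=; exists i => /=; first by rewrite mem_index_enum.
by exists Y => //; rewrite setTI.
Qed.

Lemma measurable_fun_rV d (T : measurableType d) (f : T -> 'rV[R]_n) :
  (forall i, measurable_fun [set: T] (rV_coord i \o f)) ->
  measurable_fun [set: T] f.
Proof.
move=> mf _ A mA.
have : preimage_set_system [set: T] f (g_sigma_preimage rV_coord) `<=` measurable.
  rewrite -g_sigma_preimage_comp.
  apply: smallest_sub; first exact: sigma_algebra_measurable.
  elim/big_ind: _ => // [X Y mX mY Z [/mX|/mY]//|i _ B [C mC <-]].
  exact: mf.
by apply; exists A.
Qed.

End measurable_rV.

Section lebesgue_rV.
Context {R : realType}.
Local Open Scope ereal_scope.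

Section step.
Variables (n : nat) (m : {sigma_finite_measure set 'rV[R]_n -> \bar R}).

Definition rV_cons (p : measurableTypeR R * 'rV[R]_n) : 'rV[R]_n.+1 :=
  row_mx (p.1 : R)%:M p.2.

Definition rV_uncons (v : 'rV[R]_n.+1) : measurableTypeR R * 'rV[R]_n :=
  (v ord0 ord0, \row_i v ord0 (lift ord0 i)).

Lemma rV_cons0 p : rV_cons p ord0 ord0 = p.1.
Proof.
have -> : rV_cons p ord0 ord0 =
    row_mx (p.1 : R)%:M p.2 ord0 (lshift n (ord0 : 'I_1)).
  by congr (row_mx _ _ _ _); exact/val_inj.
by rewrite row_mxEl mxE eqxx.
Qed.

Lemma rV_consS p i : rV_cons p ord0 (lift ord0 i) = p.2 ord0 i.
Proof.
have -> : rV_cons p ord0 (lift ord0 i) =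
    row_mx (p.1 : R)%:M p.2 ord0 (rshift 1 i).
  by congr (row_mx _ _ _ _); exact/val_inj.
by rewrite row_mxEr.
Qed.

Lemma rV_consK : cancel rV_cons rV_uncons.
Proof.
move=> [x v]; rewrite /rV_uncons rV_cons0; congr pair.
by apply/rowP => i; rewrite mxE rV_consS.
Qed.

Lemma measurable_rV_cons : measurable_fun setT rV_cons.
Proof.
apply: measurable_fun_rV => i; case: (unliftP ord0 i) => [j ->|->].
  rewrite (_ : _ \o _ = rV_coord j \o snd); last first.
    by apply/funext => p; exact: rV_consS.
  exact: measurableT_comp (measurable_rV_coord j) measurable_snd.
rewrite (_ : _ \o _ = fst); first exact: measurable_fst.
by apply/funext => p; exact: rV_cons0.
Qed.

Lemma measurable_rV_uncons : measurable_fun setT rV_uncons.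
Proof.
apply/measurable_fun_pairP; split; first exact: measurable_rV_coord.
apply: measurable_fun_rV => i.
rewrite (_ : _ \o _ = rV_coord (lift ord0 i)); first exact: measurable_rV_coord.
by apply/funext => v; rewrite /rV_coord/= mxE.
Qed.

Definition lebesgue_rVS : set 'rV[R]_n.+1 -> \bar R :=
  pushforward (lebesgue_measure \x m) rV_cons.

Let lebesgue_rVS0 : lebesgue_rVS set0 = 0.
Proof. by rewrite /lebesgue_rVS /pushforward preimage_set0 measure0. Qed.

Let lebesgue_rVS_ge0 A : 0 <= lebesgue_rVS A.
Proof. by rewrite /lebesgue_rVS /pushforward measure_ge0. Qed.

Let lebesgue_rVS_sigma_additive : semi_sigma_additive lebesgue_rVS.
Proof.
move=> F mF tF mUF; rewrite /lebesgue_rVS /pushforward preimage_bigcup.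
apply: measure_semi_sigma_additive.
- by move=> k; rewrite -[X in measurable X]setTI; exact: measurable_rV_cons.
- apply/trivIsetP => /= i j _ _ ij; rewrite -preimage_setI.
  by move/trivIsetP : tF => /(_ _ _ _ _ ij) ->//; rewrite preimage_set0.
- rewrite -preimage_bigcup -[X in measurable X]setTI.
  exact: measurable_rV_cons.
Qed.

HB.instance Definition _ := isMeasure.Build _ _ _ lebesgue_rVS
  lebesgue_rVS0 lebesgue_rVS_ge0 lebesgue_rVS_sigma_additive.

Let lebesgue_rVS_sigma_finite : sigma_finite setT lebesgue_rVS.
Proof.
have /sigma_finiteP[F [FT ndF Foo]] := sigma_finiteT (@lebesgue_measure R).
have /sigma_finiteP[G [GT ndG Goo]] := sigma_finiteT m.
exists (fun k => rV_uncons @^-1` (F k `*` G k)).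
  apply/esym; rewrite -subTset => v _; rewrite -preimage_bigcup.
  have [i _ Fi] : (\bigcup_i F i) (rV_uncons v).1 by rewrite -FT.
  have [j _ Gj] : (\bigcup_j G j) (rV_uncons v).2 by rewrite -GT.
  exists (maxn i j) => //; split.
  - by move: Fi; exact/subsetPset/ndF/leq_maxl.
  - by move: Gj; exact/subsetPset/ndG/leq_maxr.
move=> k; have [mF Fk] := Foo k; have [mG Gk] := Goo k; split.
  rewrite -[X in measurable X]setTI; apply: measurable_rV_uncons => //.
  exact: measurableX.
rewrite /lebesgue_rVS /pushforward -comp_preimage.
rewrite (_ : _ \o _ = id); last by apply/funext => p; exact: rV_consK.
by rewrite preimage_id product_measure1E// lte_mul_pinfty// ge0_fin_numE.
Qed.

HB.instance Definition _ := @Measure_isSigmaFinite.Build _ _ _ lebesgue_rVS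
  lebesgue_rVS_sigma_finite.

End step.

(* Lebesgue measure on R^n, as an iterated product of Lebesgue measure on R
   transported to row vectors; see [lebesgue_rV_box] below. *)
Fixpoint lebesgue_rV (n : nat) : {sigma_finite_measure set 'rV[R]_n -> \bar R} :=
  if n is n'.+1 then lebesgue_rVS (lebesgue_rV n')
  else @dirac _ 'rV[R]_0 0%R R.

Lemma lebesgue_rV_box (n : nat) (a b : 'I_n -> R) :
  (forall i, a i <= b i)%R ->
  lebesgue_rV n [set x | forall i, x ord0 i \in `]a i, b i]] =
  (\prod_i (b i - a i)%R)%:E.
Proof.
elim: n a b => [|n IH] a b ab /=.
  rewrite big_ord0 diracE mem_set//= => i; by case: i.
rewrite /lebesgue_rVS /pushforward.
rewrite [X in product_measure1 _ _ X](_ : _ = `]a ord0, b ord0]%classic `*`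
   [set x : 'rV[R]_n | forall i, x ord0 i \in `]a (lift ord0 i), b (lift ord0 i)]]); last first.
  apply/seteqP; split => -[x v]/=.
    move=> h; split; first by have := h ord0; rewrite rV_cons0.
    by move=> i; have := h (lift ord0 i); rewrite rV_consS.
  move=> [h0 h] i; case: (unliftP ord0 i) => [j ->|->].
    by rewrite rV_consS.
  by rewrite rV_cons0.
rewrite product_measure1E//.
  rewrite IH//.
  have := @lebesgue_measure_itv R `]a ord0, b ord0] => /= ->.
  rewrite lte_fin big_ord_recl EFinM; case: ltP => // ba.
  have -> : b ord0 = a ord0 by apply/eqP; rewrite eq_le ba ab.
  by rewrite subrr.
rewrite (_ : mkset _ = \bigcap_(i in [set: 'I_n])
   (rV_coord i @^-1` `]a (lift ord0 i), b (lift ord0 i)]%classic)); last first.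
  by apply/seteqP; split => x /= h i; [move=> _|]; exact: h.
apply: fin_bigcap_measurable => [|i _]; first exact: finite_finset.
rewrite -[X in measurable X]setTI.
exact: measurable_rV_coord.
Qed.

End lebesgue_rV.

(* [f \_ D] is f on D and 0 elsewhere.  Elements of L^oo are a.e. classes;
   [Lfun] takes a Borel representative. *)
Definition Linfty d (T : measurableType d) (R : realType)
    (mu : {measure set T -> \bar R}) (D : set T) (f : T -> R) :=
  f \_ D \in Lfun mu +oo%E.

(* A function on a subset of R^N x R is a total function whose values off that
   subset are arbitrary: Omega is open and the time derivative is taken within
   `]0, T], so no definition below depends on them. *)
Section spacetime.
Context {R : realType} {N : nat}.
Implicit Types (Q : set ('rV[R]_N * R)) (u : 'rV[R]_N * R -> R)
  (z : 'rV[R]_N * R) (Omega : set 'rV[R]_N) (T : R).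

Definition is_domain Omega := [/\ Omega !=set0, connected Omega & open Omega].

Definition boundary Omega := closure Omega `\` Omega°.

Definition ebase (i : 'I_N) : 'rV[R]_N := delta_mx ord0 i.

Definition dx (i : 'I_N) u z : R := 'D_(ebase i) (fun y => u (y, z.2)) z.1.

Definition laplacian u z : R := \sum_(i < N) dx i (dx i u) z.

(* The increment ranges over times in `]0, T] only, so that the derivative is
   the left one at t = T and the usual one at 0 < t < T. *)
Definition dt_quotient u z (s : R) : R := (s - z.2)^-1 * (u (z.1, s) - u z).

Definition dt_filter T (t : R) : set_system R := within `]0, T]%classic t^'.

Definition dt T u z : R := lim (dt_quotient u z @ dt_filter T z.2).

Definition C1_space Q u := forall i,
  (forall z, Q z -> derivable (fun y => u (y, z.2)) z.1 (ebase i)) /\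
  {within Q, continuous (dx i u)}.

(* All derivatives are jointly continuous in (x, t). *)
Definition C21 Omega T u := let Q := Omega `*` `]0, T] in
  [/\ {within Q, continuous u},
      C1_space Q u,
      (forall i, C1_space Q (dx i u)),
      (forall z, Q z -> cvg (dt_quotient u z @ dt_filter T z.2)) &
      {within Q, continuous (dt T u)}].

(* Convergence in L^1_loc(Omega) is L^1(K)-convergence for all compact
   K in Omega. *)
Definition cvg_L1loc_at0 Omega u (u0 : 'rV[R]_N -> R) :=
  forall K, compact K -> K `<=` Omega ->
    (\int[lebesgue_rV N]_(x in K) `|(u (x, t) - u0 x)%:E|)%E
      @[t --> 0^'+] --> 0%E.

End spacetime.

Definition C2 (R : realType) (phi : R -> R) :=
  [/\ (forall s, derivable phi s 1),
      (forall s, derivable (derive1 phi) s 1) &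
      continuous (derive1 (derive1 phi))].

(* Main.v *)
Require Import Defs.
From mathcomp Require Import all_boot all_order all_algebra.
From mathcomp Require Import all_classical all_reals all_analysis.
From mathcomp Require Import measurable_realfun ess_sup_inf ring lra.
Import Order.TTheory GRing.Theory Num.Theory.
Import numFieldNormedType.Exports.
Local Open Scope classical_set_scope.
Local Open Scope ring_scope.

(** Write [w = u - v] and [W = phi u - phi v], and extend the positive parts of
    [w] and [W] by 0 outside [Omega] ([wplus], [Wplus]).  Since [phi] is increasing
    with slopes in [[delta1, delta2]], [w] and [W] have the same sign, and
    [Wplus <= delta2 * wplus].

    Kato's inequality gives [d/dt wplus <= Laplacian Wplus] inside [Omega], and
    the point is to extend it to the whole space, across a boundary without any
    regularity.  There [Wplus] vanishes continuously, but the derivatives of [u]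
    and [v] are not controlled, and truncating [Wplus] at a positive level to stay
    away from the boundary does not commute with the time derivative of [wplus].
    The inequality is therefore first integrated in time: [Z], the integral of
    [Wplus] over [[tau, t]], satisfies [Laplacian Z >= wplus t - wplus tau], where
    time derivatives no longer occur.  The truncation of [Z] at level [delta]
    lives on a compact subset of [Omega], because [u <= v] on the boundary, and
    inherits the inequality where [Z > delta] by convexity.  Where [Z] is small,
    [wplus t] is small, by continuity in time ([positive_persists]).  This is
    [riemann_pointwise].

    Integration against a cutoff of radius [r] gives, for the mass [m s r] of
    [wplus s] in the ball of radius [r] and a constant [C],
    [r^2 * m t r <= 4 * r^2 * m tau (2 * r) + C * sup_s (m s (3 * r))]
    ([mass_step]).  As [tau] tends to 0 the first term disappears, by the ordering
    of the initial values and the boundedness of [u] and [v] ([mass_initial]).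
    Since [m s r] is at most a multiple of [r^N], iteration bounds it by multiples
    of [r^(N - 2 * p)] for every [p] ([mass_decay]); it is nondecreasing in [r],
    hence 0.

    All of this is carried out with second differences in space and Riemann sums
    in time.  For these Kato's inequality is the convexity of the positive part
    ([discrete_kato]), and integration by parts is the translation invariance of
    Lebesgue measure. *)

Set Implicit Arguments.
Unset Strict Implicit.
Unset Printing Implicit Defensive.

(** * Lebesgue measure on row vectors *)

Lemma lebesgue_measure_translate (R : realType) (a : R)
    (A : set (measurableTypeR R)) :
  measurable A ->
  lebesgue_measure ((fun x : measurableTypeR R => (x + a : measurableTypeR R)) @^-1` A)
  = lebesgue_measure A.
Proof.
move=> mA.
pose sh : measurableTypeR R -> measurableTypeR R := fun x => x + a.
have msh : measurable_fun setT sh by exact: measurable_funD.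
have H := @lebesgue_measure_unique R (pushforward lebesgue_measure sh).
rewrite [RHS]H//.
move=> _ [[x y] _ <-] /=.
rewrite /pushforward /= [X in _ = lebesgue_measure X](_ : _ = `](x - a), (y - a)]%classic); last first.
  by apply/seteqP; split => z /=; rewrite !in_itv /= /sh ltrBlDr lerBrDr.
rewrite !lebesgue_measure_itv /= !lte_fin ltrD2r.
by case: ifP => // _; rewrite -!EFinD; congr (_%:E); ring.
Qed.

Lemma measurable_rV_translate (R : realType) (n : nat) (a : 'rV[R]_n) :
  measurable_fun setT (fun x : 'rV[R]_n => x + a).
Proof.
apply: measurable_fun_rV => i.
rewrite (_ : _ \o _ = (fun x => (rV_coord i x : R) + a ord0 i)).
  by apply: measurable_funD => //; exact: measurable_rV_coord.
by apply/funext => x; rewrite /rV_coord /= mxE.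
Qed.

(** By induction on the dimension: the translate of a product measure agrees with
    it on rectangles, hence everywhere. *)
Lemma lebesgue_rV_translate (R : realType) (n : nat) (a : 'rV[R]_n)
    (A : set 'rV[R]_n) :
  measurable A ->
  lebesgue_rV n ((fun x => x + a) @^-1` A) = lebesgue_rV n A.
Proof.
elim: n a A => [|n IH] a A mA.
  by congr (lebesgue_rV _ _); apply/seteqP; split => x /=; rewrite [x + a]thinmx0 ?(thinmx0 x).
pose a' : 'rV[R]_n := \row_i a ord0 (lift ord0 i).
pose sh : measurableTypeR R * 'rV[R]_n -> measurableTypeR R * 'rV[R]_n :=
  fun p => ((p.1 : R) + a ord0 ord0, p.2 + a').
have msh : measurable_fun setT sh.
  apply/measurable_fun_pairP; split.
    by apply: (@measurable_funD _ _ _ _ fst (cst (a ord0 ord0))).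
  exact: measurableT_comp (measurable_rV_translate _) measurable_snd.
have E p : rV_cons p + a = rV_cons (sh p).
  apply/rowP => i; rewrite mxE; case: (unliftP ord0 i) => [j ->|->].
    by rewrite !rV_consS !mxE.
  by rewrite !rV_cons0.
have mB : measurable (@rV_cons R n @^-1` A).
  by rewrite -[X in measurable X]setTI; exact: measurable_rV_cons.
rewrite /= /lebesgue_rVS /pushforward.
rewrite [X in product_measure1 _ _ X](_ : _ = sh @^-1` (@rV_cons R n @^-1` A)); last first.
  by apply/seteqP; split => p /=; rewrite E.
have H := @product_measure_unique _ _ _ _ R (@lebesgue_measure R) (lebesgue_rV n)
  (pushforward (product_measure1 (@lebesgue_measure R) (lebesgue_rV n)) sh).
rewrite [RHS]H// => X Y mX mY.
rewrite /= /pushforward.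
rewrite [Z in product_measure1 _ _ Z](_ : _ = ((fun x : measurableTypeR R => (x + a ord0 ord0 : measurableTypeR R)) @^-1` X) `*` ((fun x => x + a') @^-1` Y)); last first.
  by apply/seteqP; split => -[].
have mX' : measurable ((fun x : measurableTypeR R => (x + a ord0 ord0 : measurableTypeR R)) @^-1` X).
  by rewrite -[Z in measurable Z]setTI; apply: (@measurable_funD _ _ _ _ id (cst (a ord0 ord0))).
have mY' : measurable ((fun x => x + a') @^-1` Y).
  by rewrite -[Z in measurable Z]setTI; exact: measurable_rV_translate.
rewrite product_measure1E//.
by congr (_ * _)%E; [exact: lebesgue_measure_translate|exact: IH].
Qed.

Section row_vectors.
Context {R : realType} {n : nat}.
Implicit Types (x c : 'rV[R]_n) (r : R) (U : set 'rV[R]_n).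

Lemma rV_norm_leP x r : 0 <= r -> (`|x| <= r) <-> (forall i, `|x ord0 i| <= r).
Proof.
move=> r0; rewrite [`|x|]/Num.norm /= mx_normrE; split.
  by move/bigmax_leP => [_ H] i; exact: (H (ord0, i)).
by move=> H; apply/bigmax_leP; split => // -[i j] _ /=; rewrite ord1.
Qed.

Lemma coord_le_norm x i : `|x ord0 i| <= `|x|.
Proof. by move: i; apply/rV_norm_leP. Qed.

Lemma rV_norm_coord x : (0 < n)%N -> exists i, `|x| = `|x ord0 i|.
Proof.
case: n x => // m x _; have [x0|/mx_norm_neq0[[i j] xE]] := eqVneq (mx_norm x) 0.
  by exists ord0; rewrite (mx_norm_eq0 x0) mxE !normr0.
by exists j; rewrite [LHS]xE /= (ord1 i).
Qed.

Definition cball c r := [set x | `|x - c| <= r].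

Lemma measurable_cball c r : measurable (cball c r).
Proof.
have [r0|r0] := leP 0 r; last first.
  rewrite (_ : cball c r = set0); first exact: measurable0.
  apply/seteqP; split => // x /=; rewrite /cball /= => H.
  by have := le_lt_trans H r0; rewrite normr_lt0.
rewrite (_ : cball c r = \bigcap_(i in [set: 'I_n])
   (rV_coord i @^-1` `[c ord0 i - r, c ord0 i + r]%classic)); last first.
  apply/seteqP; split => x /=.
    by move=> /rV_norm_leP-/(_ r0) H i _ /=; have := H i; rewrite !mxE ler_distl in_itv.
  move=> H; apply/rV_norm_leP => // i; have := H i Logic.I.
  by rewrite /= in_itv /= !mxE ler_distl.
apply: fin_bigcap_measurable => [|i _]; first exact: finite_finset.
by rewrite -[X in measurable X]setTI; exact: measurable_rV_coord.
Qed.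

Lemma compact_cball c r : compact (cball c r).
Proof.
apply: bounded_closed_compact.
  exists (`|c| + r); split; first exact: num_real.
  move=> M HM x /= Hx; apply: le_trans (ltW HM).
  by rewrite -[x](subrK c) addrC (le_trans (ler_normD _ _))// lerD2l.
rewrite (_ : cball c r = closed_ball_ Num.norm c r); first exact: closed_closed_ball_.
by apply/seteqP; split => x; rewrite /cball /closed_ball_ /= distrC.
Qed.

(** Every open set is the union of the closed cubes with rational data that it
    contains. *)
Lemma open_sigma_compact U : open U ->
  exists C : nat -> set 'rV[R]_n,
    (forall k, compact (C k) /\ measurable (C k)) /\ U = \bigcup_k C k.
Proof.
move=> oU.
pose B (p : 'rV[rat]_n * nat) := cball (map_mx ratr p.1) p.2.+1%:R^-1.
pose C k := if (unpickle k : option ('rV[rat]_n * nat)) is Some p then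
              if `[< B p `<=` U >] then B p else set0 else set0.
exists C; split.
  move=> k; rewrite /C; case: unpickle => [p|]; last by split; [exact: compact0|exact: measurable0].
  case: ifP => _; last by split; [exact: compact0|exact: measurable0].
  by split; [exact: compact_cball|exact: measurable_cball].
apply/seteqP; split => x.
  move=> Ux; have /nbhs_ballP[e /= e0 He] : nbhs x U by exact: open_nbhs_nbhs.
  have [k] : exists k, 0 + k.+1%:R^-1 < e / 2 by apply: ltr_add_invr; rewrite divr_gt0.
  rewrite add0r => ke; have k0 : 0 < k.+1%:R^-1 :> R by rewrite invr_gt0.
  have /choice[q Hq] : forall i, exists q : rat, `|x ord0 i - ratr q| <= k.+1%:R^-1.
    move=> i.
    have /rat_in_itvoo[q] : x ord0 i - k.+1%:R^-1 < x ord0 i + k.+1%:R^-1.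
      by rewrite ltrBlDr -addrA ltrDl addr_gt0.
    rewrite in_itv /= => /andP[q1 q2]; exists q.
    by rewrite distrC ler_distl !ltW.
  exists (pickle (\row_i q i, k)) => //.
  rewrite /C pickleK; case: asboolP => [_|[]].
    by apply/rV_norm_leP => [|i]; [exact: ltW|rewrite !mxE].
  move=> y Hy; apply: He; rewrite mx_norm_ball /ball_ /=.
  rewrite (_ : x - y = (x - map_mx ratr (\row_i q i)) - (y - map_mx ratr (\row_i q i))); last first.
    by rewrite opprB addrA subrK.
  apply: (@le_lt_trans _ _ (k.+1%:R^-1 + k.+1%:R^-1)).
    apply: (le_trans (ler_normB _ _)); rewrite lerD//.
    by apply/rV_norm_leP => [|i]; [exact: ltW|rewrite !mxE].
  by move: ke; set d := _^-1 => ke; lra.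
move=> [k _]; rewrite /C; case: unpickle => [p|//].
by case: asboolP => // H; exact: H.
Qed.

Lemma open_measurable_rV U : open U -> measurable U.
Proof.
by move=> /open_sigma_compact[C [HC ->]]; apply: bigcup_measurable => k _; have [] := HC k.
Qed.

Lemma measurable_box (a b : 'I_n -> R) :
  measurable [set x : 'rV[R]_n | forall i, x ord0 i \in `]a i, b i]].
Proof.
rewrite (_ : mkset _ = \bigcap_(i in [set: 'I_n])
   (rV_coord i @^-1` `]a i, b i]%classic)); last first.
  by apply/seteqP; split => x /= h i; [move=> _|]; exact: h.
apply: fin_bigcap_measurable => [|i _]; first exact: finite_finset.
by rewrite -[X in measurable X]setTI; exact: measurable_rV_coord.
Qed.

Lemma lebesgue_cball_le r : 0 < r ->
  (lebesgue_rV n (cball 0 r) <= ((4 * r) ^+ n)%:E)%E.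
Proof.
move=> r0.
have r2 : - (2 * r) <= 2 * r by lra.
have <- : lebesgue_rV n [set x : 'rV[R]_n | forall i, x ord0 i \in `](- (2 * r)), (2 * r)]] =
  ((4 * r) ^+ n)%:E.
  rewrite (@lebesgue_rV_box R n (fun=> - (2 * r)) (fun=> 2 * r))//.
  by rewrite prodr_const card_ord; congr ((_ ^+ _)%:E); ring.
apply: le_measure; rewrite ?inE.
- exact: measurable_cball.
- exact: (measurable_box (fun=> - (2 * r)) (fun=> 2 * r)).
move=> x; rewrite /cball /= subr0 => H i; rewrite in_itv /=.
have := le_trans (coord_le_norm x i) H; rewrite ler_norml => /andP[]; lra.
Qed.

Lemma lebesgue_ball_gt0 c r : 0 < r -> (0 < lebesgue_rV n (ball c r))%E.
Proof.
move=> r0.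
have H i : c ord0 i - r / 2 <= c ord0 i + r / 2 by lra.
have := lebesgue_rV_box H; rewrite (eq_bigr (fun=> r)); last by move=> i _; lra.
rewrite prodr_const card_ord => E.
apply: (@lt_le_trans _ _ (r ^+ n)%:E); first by rewrite lte_fin exprn_gt0.
rewrite -E; apply: le_measure; rewrite ?inE.
- exact: (measurable_box (fun i => c ord0 i - r / 2) (fun i => c ord0 i + r / 2)).
- by apply: open_measurable_rV; exact: ball_open.
move=> x /= Hx; rewrite mx_norm_ball /ball_ /=.
apply: (@le_lt_trans _ _ (r / 2)); last by lra.
apply/rV_norm_leP => [|i]; first by lra.
by have := Hx i; rewrite in_itv /= !mxE ler_distl => /andP[]; lra.
Qed.

End row_vectors.

(** * Integration of bounded functions with bounded support *)

Section bounded_integration.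
Context {R : realType} {n : nat}.
Local Notation mu := (lebesgue_rV n : {measure set 'rV[R]_n -> \bar R}).
Implicit Types (f g : 'rV[R]_n -> R) (a x : 'rV[R]_n) (c r M : R).

Lemma measurable_superlevel f : (forall x, 0 <= f x) ->
  (forall c, 0 <= c -> measurable [set x | c < f x]) ->
  measurable_fun [set: 'rV[R]_n] f.
Proof.
move=> f0 H mD; apply: (measurability _ (RGenOInfty.measurableE R)) => //.
move=> _ [_ [c ->] <-]; rewrite setTI.
have [c0|c0] := leP 0 c.
  rewrite (_ : _ @^-1` _ = [set x | c < f x]); first exact: H.
  by apply/seteqP; split => x /=; rewrite in_itv /= andbT.
rewrite (_ : _ @^-1` _ = setT); first exact: measurableT.
by apply/seteqP; split => x //= _; rewrite in_itv /= andbT (lt_le_trans c0).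
Qed.

(** A class of integrable functions that contains all the integrands below and is
    stable under sums, translations and products with bounded measurable
    functions. *)
Definition bounded_local f :=
  [/\ measurable_fun [set: 'rV[R]_n] f, (exists M, forall x, `|f x| <= M)
    & exists r, forall x, r < `|x| -> f x = 0].

Local Notation I f := (\int[mu]_x f x).

Lemma lebesgue_cball_lty r : (mu (cball 0 r) < +oo)%E.
Proof.
apply: (@le_lt_trans _ _ (mu (cball 0 (Num.max r 1)))).
  apply: le_measure; rewrite ?inE; [exact: measurable_cball|exact: measurable_cball|].
  by move=> x; rewrite /cball /= => H; rewrite le_max H.
have r0 : 0 < Num.max r 1 by rewrite lt_max ltr01 orbT.
by apply: le_lt_trans (lebesgue_cball_le r0) _; rewrite ltry.
Qed.

Lemma integrable_cball r : mu.-integrable setT (EFin \o \1_(cball 0 r)).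
Proof.
apply/integrableP; split.
  by apply/measurable_EFinP; apply: measurable_indic; exact: measurable_cball.
rewrite (eq_integral (fun x => (\1_(cball 0 r) x)%:E)); last first.
  by move=> x _ /=; rewrite ger0_norm.
rewrite integral_indic//; last exact: measurable_cball.
by rewrite setIT lebesgue_cball_lty.
Qed.

Lemma bounded_local_integrable f : bounded_local f -> mu.-integrable setT (EFin \o f).
Proof.
move=> [mf [M fM] [r fr]].
apply: (@le_integrable _ _ _ _ _ _ _ (fun x => (M * \1_(cball 0 r) x)%:E)) => //.
- exact/measurable_EFinP.
- move=> x _ /=; rewrite lee_fin; have [xr|xr] := leP `|x| r.
    by rewrite indicE mem_set ?mulr1 /cball /= ?subr0// (le_trans (fM x))// ler_norm.
  by rewrite fr// normr0.
exact: (integrableZl _ _ (integrable_cball r)).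
Qed.

Lemma bounded_local_indic (A : set 'rV[R]_n) r : measurable A -> A `<=` cball 0 r ->
  bounded_local \1_A.
Proof.
move=> mA Ar; split; first exact: measurable_indic.
  by exists 1 => x; rewrite ger0_norm// indicE lern1 leq_b1.
exists r => x xr; rewrite indicE memNset// => /Ar; rewrite /cball /= subr0.
by rewrite leNgt xr.
Qed.

Lemma bounded_local_cball r : bounded_local \1_(cball 0 r).
Proof. exact: bounded_local_indic (measurable_cball _ _) (@subset_refl _ _). Qed.

Lemma bounded_localD f g : bounded_local f -> bounded_local g ->
  bounded_local (fun x => f x + g x).
Proof.
move=> [mf [M fM] [r fr]] [mg [M' gM] [r' gr]]; split.
- exact: measurable_funD.
- by exists (M + M') => x; rewrite (le_trans (ler_normD _ _))// lerD.
by exists (Num.max r r') => x; rewrite gt_max => /andP[? ?]; rewrite fr// gr// addr0.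
Qed.

Lemma bounded_localM f g : bounded_local f -> measurable_fun setT g ->
  (exists M, forall x, `|g x| <= M) -> bounded_local (fun x => f x * g x).
Proof.
move=> [mf [M fM] [r fr]] mg [M' gM]; split.
- exact: measurable_funM.
- by exists (M * M') => x; rewrite normrM ler_pM.
by exists r => x H; rewrite fr// mul0r.
Qed.

Lemma bounded_localZ c f : bounded_local f -> bounded_local (fun x => c * f x).
Proof.
move=> H; have : bounded_local (fun x => f x * cst c x).
  by apply: bounded_localM => //; exists `|c|.
by congr bounded_local; apply/funext => x; rewrite mulrC.
Qed.

Lemma bounded_local_sum (J : Type) (s : seq J) (F : J -> 'rV[R]_n -> R) :
  (forall j, bounded_local (F j)) -> bounded_local (fun x => \sum_(j <- s) F j x).
Proof.
move=> H; elim: s => [|j s IH].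
  under eq_fun do rewrite big_nil.
  split; [exact: measurable_cst|by exists 0 => x; rewrite normr0|by exists 0].
under eq_fun do rewrite big_cons.
exact: bounded_localD.
Qed.

Lemma bounded_local_translate a f : bounded_local f -> bounded_local (fun x => f (x + a)).
Proof.
move=> [mf [M fM] [r fr]]; split; first exact: measurableT_comp mf (measurable_rV_translate a).
  by exists M.
exists (r + `|a|) => x H; apply: fr.
rewrite -(ltrD2r `|a|) (lt_le_trans H)//.
by rewrite -{1}(addrK a x) (le_trans (ler_normB _ _)).
Qed.

Lemma local_integral_translate a f : bounded_local f -> I (fun x => f (x + a)) = I f.
Proof.
move=> bf; have [mf _ _] := bf; congr fine.
have mt : measurable_fun setT (fun x : 'rV[R]_n => x + a) by exact: measurable_rV_translate.
rewrite -[LHS](@integral_pushforward _ _ _ _ _ (fun x => x + a) _ mu setT (EFin \o f))//.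
- apply: eq_measure_integral => A mA _.
  exact: (lebesgue_rV_translate a mA).
- exact/measurable_EFinP.
- exact: (bounded_local_integrable (bounded_local_translate a bf)).
Qed.

Lemma local_integral_le f g : bounded_local f -> bounded_local g ->
  (forall x, f x <= g x) -> I f <= I g.
Proof.
by move=> bf bg H; apply: le_Rintegral => //; exact: bounded_local_integrable.
Qed.

Lemma local_integralD f g : bounded_local f -> bounded_local g ->
  I (fun x => f x + g x) = I f + I g.
Proof. by move=> bf bg; rewrite RintegralD//; exact: bounded_local_integrable. Qed.

Lemma local_integralZ c f : bounded_local f -> I (fun x => c * f x) = c * I f.
Proof. by move=> bf; rewrite RintegralZl//; exact: bounded_local_integrable. Qed.

Lemma local_integral_sum (J : Type) (s : seq J) (F : J -> 'rV[R]_n -> R) :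
  (forall j, bounded_local (F j)) ->
  I (fun x => \sum_(j <- s) F j x) = \sum_(j <- s) I (F j).
Proof.
move=> H; elim: s => [|j s IH].
  under eq_Rintegral do rewrite big_nil.
  by rewrite Rintegral_cst// mul0r big_nil.
rewrite big_cons -IH -local_integralD//; last exact: bounded_local_sum.
by apply: eq_Rintegral => x _; rewrite big_cons.
Qed.

Lemma local_integral_cball_le r : 0 < r -> I (\1_(cball 0 r)) <= (4 * r) ^+ n.
Proof.
move=> r0; rewrite /Rintegral integral_indic//; last exact: measurable_cball.
rewrite setIT -lee_fin fineK; first exact: lebesgue_cball_le.
by rewrite ge0_fin_numE// lebesgue_cball_lty.
Qed.

End bounded_integration.

(** * Calculus on lines *)

Section calculus.
Context {R : realType}.

(** Two applications of the mean value theorem: one to the even part of [f]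
    corrected by a quadratic term that vanishes at both ends, one to [f1]. *)
Lemma second_difference_mean (f f1 f2 : R -> R) (h : R) : 0 < h ->
  (forall s, `|s| <= h -> is_derive s (1 : R) f (f1 s)) ->
  (forall s, `|s| <= h -> is_derive s (1 : R) f1 (f2 s)) ->
  exists2 y, `|y| <= h & f h + f (- h) - f 0 *+ 2 = f2 y * h ^+ 2.
Proof.
move=> h0 H1 H2; pose c := (f h + f (- h) - f 0 *+ 2) / h ^+ 2.
have cont (g g1 : R -> R) a b : (forall s, `|s| <= h -> is_derive s (1 : R) g (g1 s)) ->
    - h <= a -> b <= h -> {within `[a, b], continuous g}.
  move=> Hg ha hb; apply: derivable_within_continuous => s; rewrite in_itv /= => /andP[sa sb].
  have /Hg : `|s| <= h by rewrite ler_norml (le_trans ha)//= (le_trans sb).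
  by case.
pose G s := f s + f (- s) - c * s ^+ 2.
pose G1 s := f1 s - f1 (- s) - c * (2 * s).
have dG s : `|s| <= h -> is_derive s (1 : R) G (G1 s).
  move=> sh; have d1 := H1 s sh.
  have d2 : is_derive (- s) (1 : R) f (f1 (- s)) by apply: H1; rewrite normrN.
  have d3 : is_derive s (1 : R) (fun s => f (- s)) (- f1 (- s)).
    have := @is_derive1_comp R f (@GRing.opp R) s (f1 (- s)) (- 1) d2 _.
    by rewrite mulrN1; apply; exact: is_deriveNid.
  rewrite /G /G1; apply: is_derive_eq.
  by rewrite /GRing.scale /=; ring.
have zin s : s \in `]0, h[ -> `|s| <= h.
  by rewrite in_itv /= => /andP[? ?]; rewrite ler_norml; apply/andP; split; lra.
have dG' s : s \in `]0, h[ -> is_derive s (1 : R) G (G1 s) by move=> /zin; exact: dG.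
have cG : {within `[0, h], continuous G}.
  by apply: (cont G G1) => //; lra.
have [x xh Ex] := MVT h0 dG' cG.
move: xh; rewrite in_itv /= => /andP[x0 xh].
have xx : - x < x by lra.
have xin s : s \in `](- x), x[ -> `|s| <= h.
  by rewrite in_itv /= => /andP[? ?]; rewrite ler_norml; apply/andP; split; lra.
have df1 s : s \in `](- x), x[ -> is_derive s (1 : R) f1 (f2 s) by move=> /xin; exact: H2.
have cf1 : {within `[(- x), x], continuous f1}.
  by apply: (cont f1 f2) => //; lra.
have [y yx Ey] := MVT xx df1 cf1.
exists y; first exact: xin.
have hn0 : h != 0 by rewrite gt_eqF.
have x2 : 2 * x != 0 by rewrite gt_eqF// mulr_gt0.
have G0 : G1 x = 0.
  apply: (mulIf (_ : h - 0 != 0)); first by rewrite subr0.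
  by rewrite -Ex mul0r /G oppr0 expr0n /= mulr0 subr0 /c divfK ?expf_neq0//; ring.
rewrite -[LHS](divfK (expf_neq0 2 hn0)) -/c; congr (_ * _).
apply: (mulfI x2); move/eqP: G0; rewrite /G1 Ey subr_eq0 => /eqP E.
by rewrite mulrC -E; ring.
Qed.

Lemma is_derive_line (V : normedModType R) (g : V -> R) (x a : V) (s : R) :
  derivable g (x + s *: a) a ->
  is_derive s (1 : R) (fun s => g (x + s *: a)) ('D_a g (x + s *: a)).
Proof.
move=> dg.
have E : (fun h => h^-1 *: (((fun s => g (x + s *: a)) \o shift s) (h *: (1 : R)) - g (x + s *: a))) =
         (fun h => h^-1 *: ((g \o shift (x + s *: a)) (h *: a) - g (x + s *: a))).
  apply/funext => h /=; congr (_ *: (g _ - _)).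
  by rewrite /shift /= scalerDl /GRing.scale /= mulr1 addrCA.
by split; [rewrite /derivable E|rewrite /derive E].
Qed.

End calculus.

(** * Uniformity on compact sets *)

Section compactness.
Context {R : realType}.

Lemma within_continuous_ball (X : pseudoMetricType R) (Q : set X) (g : X -> R) z e :
  {within Q, continuous g} -> Q z -> 0 < e ->
  exists2 d, 0 < d & forall z', Q z' -> ball z d z' -> `|g z' - g z| < e.
Proof.
move=> /subspace_continuousP cg Qz e0.
have /cvgrPdist_lt /(_ e e0) := cg z Qz.
move=> /nbhs_ballP[d /= d0 H]; exists d => // z' Qz' zz'.
by rewrite distrC; exact: H.
Qed.

(** Uniform continuity with one point in [K] and the other in the larger set [Q]:
    the increments below start in a compact set and may leave it. *)
Lemma within_continuous_unif (X : pseudoMetricType R) (Q K : set X) (g : X -> R) e :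
  {within Q, continuous g} -> compact K -> K `<=` Q -> 0 < e ->
  exists2 d, 0 < d &
    forall z z', K z -> Q z' -> ball z d z' -> `|g z' - g z| <= e.
Proof.
move=> cg /compact_near_coveringP/near_covering_withinP cK KQ e0.
pose P d z := forall z', Q z' -> ball z d z' -> `|g z' - g z| <= e.
have /nbhs_ballP[d /= d0 H] : \forall d \near 0^'+, K `<=` P d.
  apply: cK => z Kz.
  have [d d0 Hd] := within_continuous_ball cg (KQ _ Kz) (divr_gt0 e0 (ltr0n _ 2)).
  exists (ball z (d / 2), [set r | r < d / 2]) => /=.
    split; first by apply: nbhsx_ballx; rewrite divr_gt0.
    exact: nbhs_right_lt (divr_gt0 d0 (ltr0n _ 2)).
  move=> [z' r] [/= zz' rd] Kz' z'' Qz'' z'z''.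
  have b2 : ball z d z''.
    rewrite (splitr d); apply: ball_triangle zz' _.
    exact: le_ball (ltW rd) _ z'z''.
  have b1 : ball z d z' by apply: le_ball zz'; lra.
  have := Hd _ Qz'' b2; have := Hd _ (KQ _ Kz') b1.
  rewrite -(distrC (g z)) => h1 h2.
  rewrite -[_ - _](subrKA (g z)) (le_trans (ler_normD _ _))//.
  by rewrite [leRHS](splitr e) lerD// ltW.
exists (d / 2); first by rewrite divr_gt0.
move=> z z' Kz; apply: (H (d / 2)) => //=; last by rewrite divr_gt0.
by rewrite /ball /= sub0r normrN gtr0_norm; lra.
Qed.

Lemma compact_superlevel (X : topologicalType) (A : set X) (g : X -> R) c :
  {within A, continuous g} -> compact A -> compact [set z | A z /\ c <= g z].
Proof.
move=> cg cA.
have : closed ((g : subspace A -> R) @^-1` [set t | c <= t]).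
  by apply: closed_comp; [move=> z _; exact: cg|exact: closed_ge].
move=> /closed_subspaceP[V cV VA].
rewrite (_ : mkset _ = A `&` V); first exact: compact_closedI.
apply/seteqP; split => z /=.
  by move=> [Az gz]; split => //; have [] : (V `&` A) z by rewrite VA.
by move=> [Az Vz]; split => //; have [] : ((g : subspace A -> R) @^-1` [set t | c <= t] `&` A) z by rewrite -VA.
Qed.

Lemma compact_open_ball (X : pseudoMetricType R) (K U : set X) :
  compact K -> open U -> K `<=` U ->
  exists2 d, 0 < d & forall x, K x -> ball x d `<=` U.
Proof.
move=> /compact_near_coveringP cK oU KU.
have /nbhs_ballP[d /= d0 H] : \forall d \near (0 : R)^'+, K `<=` (fun x => ball x d `<=` U).
  apply: cK => z /KU Uz.
  have /nbhs_ballP[d /= d0 Hd] : nbhs z U by exact: open_nbhs_nbhs.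
  exists (ball z (d / 2), [set r | r < d / 2]) => /=.
    split; first by apply: nbhsx_ballx; rewrite divr_gt0.
    exact: nbhs_right_lt (divr_gt0 d0 (ltr0n _ 2)).
  move=> [z' r] [/= zz' rd] z'' z'z''; apply: Hd.
  rewrite (splitr d); apply: ball_triangle zz' _.
  exact: le_ball (ltW rd) _ z'z''.
exists (d / 2); first by rewrite divr_gt0.
move=> x Kx; apply: (H (d / 2)) => //=; last by rewrite divr_gt0.
by rewrite /ball /= sub0r normrN gtr0_norm; lra.
Qed.

End compactness.

(** * Derivatives along coordinate lines *)

Section line_derivatives.
Context {R : realType} {N : nat}.
Variables (phi : R -> R) (Omega : set 'rV[R]_N) (T : R) (u : 'rV[R]_N * R -> R).
Hypotheses (hphi : C2 phi) (oOmega : open Omega) (hu : C21 Omega T u).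
Local Notation Q := (Omega `*` `]0, T]).
Local Notation e_ i := (@ebase R N i).

Lemma derive_line (V : normedModType R) (g : V -> R) (x a : V) :
  'D_a g x = 'D_1 (fun s : R => g (x + s *: a)) 0.
Proof.
rewrite /derive.
have -> : (fun h => h^-1 *: (((fun s => g (x + s *: a)) \o shift 0) (h *: (1 : R)) - g (x + 0 *: a))) =
         (fun h => h^-1 *: ((g \o shift x) (h *: a) - g x)); last by [].
apply/funext => h /=; congr (_ *: (g _ - g _)); last by rewrite scale0r addr0.
by rewrite /shift /= addr0 /GRing.scale /= mulr1 addrC.
Qed.

(** The second derivative of [phi \o u] in the direction [i], by the chain rule. *)
Definition phi_dxx i z : R :=
  derive1 (derive1 phi) (u z) * dx i u z ^+ 2 + derive1 phi (u z) * dx i (dx i u) z.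

Let is_derive_phi s : is_derive s (1 : R) phi (derive1 phi s).
Proof. by have [d1 _ _] := hphi; split; [exact: d1|rewrite derive1E]. Qed.

Let is_derive_phi1 s : is_derive s (1 : R) (derive1 phi) (derive1 (derive1 phi) s).
Proof. by have [_ d2 _] := hphi; split; [exact: d2|rewrite [RHS]derive1E]. Qed.

Let is_derive_u i x s t : Q (x + s *: e_ i, t) ->
  is_derive s (1 : R) (fun s => u (x + s *: e_ i, t)) (dx i u (x + s *: e_ i, t)).
Proof.
move=> Qz; have [_ /(_ i)[d1 _] _ _ _] := hu.
exact: (is_derive_line (d1 _ Qz)).
Qed.

Let is_derive_dxu i x s t : Q (x + s *: e_ i, t) ->
  is_derive s (1 : R) (fun s => dx i u (x + s *: e_ i, t)) (dx i (dx i u) (x + s *: e_ i, t)).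
Proof.
move=> Qz; have [_ _ /(_ i i)[d1 _] _ _] := hu.
exact: (is_derive_line (d1 _ Qz)).
Qed.

Lemma is_derive_phi_line i x s t : Q (x + s *: e_ i, t) ->
  is_derive s (1 : R) (fun s => phi (u (x + s *: e_ i, t)))
    (derive1 phi (u (x + s *: e_ i, t)) * dx i u (x + s *: e_ i, t)).
Proof.
move=> Qz.
exact: (@is_derive1_comp R phi (fun s => u (x + s *: e_ i, t)) s _ _ (is_derive_phi _) (is_derive_u Qz)).
Qed.

Lemma is_derive_phi_line2 i x s t : Q (x + s *: e_ i, t) ->
  is_derive s (1 : R) (fun s => derive1 phi (u (x + s *: e_ i, t)) * dx i u (x + s *: e_ i, t))
    (phi_dxx i (x + s *: e_ i, t)).
Proof.
move=> Qz.
have H1 := @is_derive1_comp R (derive1 phi) (fun s => u (x + s *: e_ i, t)) s _ _ (is_derive_phi1 _) (is_derive_u Qz).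
have H := @is_deriveM R R _ _ s 1 _ _ H1 (is_derive_dxu Qz).
apply: is_derive_eq H _.
by rewrite /phi_dxx /GRing.scale /=; ring.
Qed.

Lemma laplacian_phiE z : Q z -> laplacian (phi \o u) z = \sum_i phi_dxx i z.
Proof.
have dxE i y t : Q (y, t) -> dx i (phi \o u) (y, t) = derive1 phi (u (y, t)) * dx i u (y, t).
  move=> Qy; rewrite /dx /= derive_line.
  have := @is_derive_phi_line i y 0 t; rewrite scale0r addr0 => /(_ Qy) H.
  by rewrite derive_val.
case: z => x t Qz; apply: eq_bigr => i _.
rewrite {1}/dx /= derive_line.
have := @is_derive_phi_line2 i x 0 t; rewrite scale0r addr0 => /(_ Qz) H.
rewrite -[RHS](@derive_val _ _ _ _ _ _ _ H).
apply: near_eq_derive => //.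
have [/= Ox t0] := Qz.
have c0 : (fun s : R => x + s *: e_ i) @ (0 : R) --> x + (0 : R) *: e_ i.
  have c1 : (fun s : R => s *: e_ i) @ (0 : R) --> (0 : R) *: e_ i.
    exact: (@cvgZr_tmp _ _ _ _ _ (fun s : R => s) 0 (e_ i) cvg_id).
  exact: (cvgD (cvg_cst x) c1).
rewrite scale0r addr0 in c0.
have nO : \forall s \near (0 : R), Omega (x + s *: e_ i).
  exact: (c0 Omega (open_nbhs_nbhs (conj oOmega Ox))).
near=> s; apply: dxE; split => //=; near: s; exact: nO.
Unshelve. all: by end_near. Qed.

Lemma within_continuous_phi_dxx i : {within Q, continuous (phi_dxx i)}.
Proof.
have [cphi d2 c2] := hphi.
have [cu /(_ i)[_ cd] /(_ i i)[_ cdd] _ _] := hu.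
apply/subspace_continuousP => z Qz.
move/subspace_continuousP : cu => /(_ _ Qz) cu.
move/subspace_continuousP : cd => /(_ _ Qz) cd.
move/subspace_continuousP : cdd => /(_ _ Qz) cdd.
have cphi1 : {for u z, continuous (derive1 phi)}.
  by apply: differentiable_continuous; apply/derivable1_diffP; exact: d2.
have FF : Filter (within Q (nbhs z)) by exact: within_filter.
have c1 := cvgM (cvg_comp u _ cu (c2 (u z))) (cvgM cd cd).
have c3 := cvgM (cvg_comp u _ cu cphi1) cdd.
have -> : phi_dxx i = ((derive1 (derive1 phi) \o u) * (dx i u * dx i u) +
    (derive1 phi \o u) * dx i (dx i u) : _ -> R).
  by apply/funext => y; rewrite /phi_dxx expr2.
have c4 := cvgD (c1 FF FF) (c3 FF).
exact: c4.
Qed.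

(** The intermediate time lies strictly between [s] and [t], so that the one-sided
    derivative at time [T] is not involved. *)
Lemma time_mean_value x s t : Omega x -> 0 < s -> s < t -> t <= T ->
  exists2 r, s < r < t & u (x, t) - u (x, s) = dt T u (x, r) * (t - s).
Proof.
move=> Ox s0 st tT.
have [cu _ _ cdt _] := hu.
have dr r : r \in `]s, t[ -> is_derive r (1 : R) (fun r => u (x, r)) (dt T u (x, r)).
  rewrite in_itv /= => /andP[sr rt].
  have Qr : Q (x, r) by split => //=; rewrite in_itv /=; apply/andP; split; lra.
  have H : dt_quotient u (x, r) @ dt_filter T r --> dt T u (x, r) by exact: (cdt _ Qr).
  have FF : Filter (dt_filter T r) by exact: within_filter.
  have H' : (fun h => h^-1 *: (((fun r => u (x, r)) \o shift r) (h *: (1 : R)) - u (x, r)))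
      @ 0^' --> dt T u (x, r).
    apply/cvgrPdist_lt => e e0.
    move/cvgrPdist_lt : H => /(_ e e0) /nbhs_ballP[d /= d0 H].
    pose d' := Num.min d (Num.min r (T - r)).
    have d'0 : 0 < d' by rewrite !lt_min d0/=; apply/andP; split; lra.
    (* Steps shorter than [d'] keep [r + h] inside [`]0, T]]. *)
    apply/nbhs_ballP; exists d' => //= h; rewrite /ball /= sub0r normrN => hd h0.
    move: hd; rewrite !lt_min => /and3P[hd hr hT].
    rewrite /GRing.scale /= mulr1.
    have := H (h + r); rewrite /ball /= opprD addrC subrK normrN => /(_ hd).
    have -> : h + r != r by rewrite -subr_eq0 addrK.
    rewrite in_itv /= /dt_quotient /= addrK; apply => //.
    by move: hr hT; rewrite !ltr_norml => /andP[? ?] /andP[? ?]; apply/andP; split; lra.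
  split; first by apply/cvg_ex; exists (dt T u (x, r)).
  exact: (cvg_lim _ H').
have cr : {within `[s, t], continuous (fun r => u (x, r))}.
  apply/subspace_continuousP => r; rewrite /= in_itv /= => /andP[sr rt].
  have Qr : Q (x, r) by split => //=; rewrite in_itv /=; apply/andP; split; lra.
  apply/cvgrPdist_lt => e e0.
  have [d d0 H] := within_continuous_ball cu Qr e0.
  apply/nbhs_ballP; exists d => //= r' rr'; rewrite in_itv /= => /andP[sr' rt'].
  rewrite distrC; apply: H; last by split => //=; exact: ballxx.
  by split => //=; rewrite in_itv /=; apply/andP; split; lra.
by have [r rst E] := MVT st dr cr; exists r => //; move: rst; rewrite in_itv.
Qed.

Lemma ball_line (x : 'rV[R]_N) (h d : R) i : `|h| < d -> ball x d (x + h *: e_ i).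
Proof.
move=> hd; rewrite mx_norm_ball /ball_ /= opprD addNKr normrN normrZ.
rewrite (le_lt_trans _ hd)// ler_piMr//; apply/rV_norm_leP => // j.
by rewrite /ebase mxE eqxx /=; case: (_ == _); rewrite ?normr1 ?normr0.
Qed.

Section uniform_increments.
Variables (K : set 'rV[R]_N) (tau e : R).
Hypotheses (cK : compact K) (KO : K `<=` Omega) (tau0 : 0 < tau) (e0 : 0 < e).

Let cKT : compact (K `*` `[tau, T]).
Proof. by apply: compact_setX => //; exact: segment_compact. Qed.

Let KQ : K `*` `[tau, T] `<=` Q.
Proof.
move=> [x s] [/= Kx]; rewrite in_itv /= => /andP[ts sT]; split; first exact: KO.
by rewrite /= in_itv /= sT (lt_le_trans tau0).
Qed.

Lemma time_increment : exists2 d, 0 < d & forall k x s, 0 < k < d -> K x ->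
  tau + k <= s <= T ->
  `|u (x, s) - u (x, s - k) - k * dt T u (x, s)| <= k * e.
Proof.
have [_ _ _ _ cdt] := hu.
have [d d0 Hd] := within_continuous_unif cdt cKT KQ e0.
exists d => // k x s /andP[k0 kd] Kx /andP[ts sT].
have sk0 : 0 < s - k by rewrite subr_gt0 (lt_le_trans _ ts)// ltrDr.
have sks : s - k < s by lra.
have [r /andP[skr rs] ->] := time_mean_value (KO Kx) sk0 sks sT.
rewrite subKr mulrC -mulrBr normrM gtr0_norm// ler_wpM2l ?(ltW k0)//.
apply: Hd.
- by split => //=; rewrite in_itv /=; apply/andP; split; lra.
- by split => /=; [exact: KO|rewrite in_itv /=; apply/andP; split; lra].
by split => /=; [exact: ballxx|rewrite /ball /= ltr_norml; apply/andP; split; lra].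
Qed.

Lemma laplacian_increment : exists2 d, 0 < d & forall h x s, 0 < h < d -> K x ->
  tau <= s <= T ->
  (forall i, Omega (x + h *: e_ i) /\ Omega (x - h *: e_ i)) /\
  `|\sum_i (phi (u (x + h *: e_ i, s)) + phi (u (x - h *: e_ i, s)) - phi (u (x, s)) *+ 2)
    - h ^+ 2 * laplacian (phi \o u) (x, s)| <= h ^+ 2 * e.
Proof.
have [d1 d10 Hd1] := compact_open_ball cK oOmega KO.
have N0 : (0 : R) < N.+1%:R by rewrite ltr0n.
have e'0 : 0 < e / N.+1%:R by rewrite divr_gt0.
have /choice[df Hdf] : forall i, exists d, 0 < d /\
    forall z z', (K `*` `[tau, T]) z -> Q z' -> ball z d z' ->
      `|phi_dxx i z' - phi_dxx i z| <= e / N.+1%:R.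
  move=> i.
  have [d d0 H] := within_continuous_unif (@within_continuous_phi_dxx i) cKT KQ e'0.
  by exists d.
exists (Num.min d1 (\big[Num.min/1]_i df i)).
  by rewrite lt_min d10; apply/bigmin_gtP; split => // i _; have [] := Hdf i.
move=> h x s /andP[h0 +] Kx tsT.
rewrite lt_min => /andP[hd1 hd].
have Oline i r : `|r| <= h -> Omega (x + r *: e_ i).
  by move=> rh; apply: (Hd1 _ Kx); apply: ball_line; exact: le_lt_trans rh hd1.
have hP : `|h| <= h by rewrite gtr0_norm.
have hN : `|- h| <= h by rewrite normrN.
split.
  by move=> i; split; [exact: Oline|rewrite -scaleNr; exact: Oline].
have Kxs : (K `*` `[tau, T]) (x, s) by split => //=; rewrite in_itv.
have Qxs := KQ Kxs.
rewrite (laplacian_phiE Qxs) mulr_sumr -sumrB (le_trans (ler_norm_sum _ _ _))//.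
apply: (@le_trans _ _ (\sum_(i < N) h ^+ 2 * (e / N.+1%:R))).
  apply: ler_sum => i _.
  have Qr r : `|r| <= h -> Q (x + r *: e_ i, s).
    by move=> rh; split => /=; [exact: Oline|case: Qxs].
  have [y yh] := second_difference_mean h0 (fun r rh => is_derive_phi_line (Qr r rh))
    (fun r rh => is_derive_phi_line2 (Qr r rh)).
  rewrite scale0r addr0 scaleNr => ->.
  rewrite mulrC -mulrBr normrM ger0_norm ?exprn_ge0 ?(ltW h0)//.
  rewrite ler_wpM2l ?exprn_ge0 ?(ltW h0)//.
  have [dfi0] := Hdf i; apply => //; first exact: Qr.
  split => /=; last exact: ballxx.
  apply: ball_line; apply: le_lt_trans yh _; apply: lt_le_trans hd _.
  exact: bigmin_le_cond.
rewrite -mulr_sumr sumr_const card_ord ler_wpM2l ?exprn_ge0 ?(ltW h0)//.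
rewrite -[leLHS]mulr_natr -mulrA ler_piMr ?(ltW e0)// mulrC ler_pdivrMr// mul1r ler_nat.
exact: leqnSn.
Qed.

End uniform_increments.

End line_derivatives.

(** * A cutoff function *)

Section cutoff.
Context {R : realType} {N : nat}.
Implicit Types (x : 'rV[R]_N) (r h : R).

(** The squared distance to the complement of the ball of radius [2 r].  As the
    norm is the maximum norm, it is a minimum of functions of one coordinate, and
    its second differences are bounded above, uniformly in [r]. *)
Definition cutoff r x : R := Num.max (2 * r - `|x|) 0 ^+ 2.

Let chi (a s : R) := Num.max (a - `|s|) 0 ^+ 2.

Let chi_le a s b : a - `|s| <= `|b| -> chi a s <= b ^+ 2.
Proof.
move=> H; rewrite /chi -(real_normK (num_real b)) lerXn2r ?nnegrE ?le_max ?lexx ?orbT//.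
by rewrite ge_max H normr_ge0.
Qed.

(** [chi a s] is the squared distance from [s] to the complement of [(-a, a)],
    hence an infimum of functions whose second differences are all [2 h^2]; it is
    compared with the function attaining the infimum. *)
Let chi_second_difference a s h : chi a (s + h) + chi a (s - h) - chi a s *+ 2 <= 2 * h ^+ 2.
Proof.
have [y [ya ys]] : exists y, a <= `|y| /\ chi a s = (s - y) ^+ 2.
  have [sa|sa] := leP a `|s|.
    by exists s; split => //; rewrite /chi max_r ?subr_le0// subrr.
  have [s0|s0] := leP 0 s.
    exists a; split; first exact: ler_norm.
    by rewrite /chi max_l ?subr_ge0 ?(ltW sa)// ger0_norm// -sqrrN opprB.
  exists (- a); split; first by rewrite normrN ler_norm.
  by rewrite /chi max_l ?subr_ge0 ?(ltW sa)// ltr0_norm// opprK addrC opprK.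
have H t : chi a t <= (t - y) ^+ 2.
  apply: chi_le; rewrite lerBlDr (le_trans ya)//.
  by rewrite addrC -{1}(subKr t y) ler_normB.
have := H (s + h); have := H (s - h); rewrite ys; lra.
Qed.

(** The cutoff is compared with the function of the coordinate [j] at which
    [`|x|] is attained; it lies below that function everywhere and agrees with it
    at [x]. *)
Lemma cutoff_second_difference r h x i : (0 < N)%N -> 0 < h <= r ->
  cutoff r (x + h *: ebase i) + cutoff r (x - h *: ebase i) - cutoff r x *+ 2
    <= 2 * h ^+ 2 * \1_(cball 0 (3 * r)) x.
Proof.
move=> N0 /andP[h0 hr].
have eN : `|h *: ebase i : 'rV[R]_N| <= h.
  apply/rV_norm_leP => [|j]; first exact: ltW.
  by rewrite !mxE eqxx /=; case: (_ == _); rewrite ?mulr1 ?mulr0 ?normr0 ?gtr0_norm// ltW.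
have [xr|xr] := leP `|x| (3 * r); last first.
  rewrite indicE memNset ?mulr0; last by rewrite /cball /= subr0 => /(lt_le_trans xr); rewrite ltxx.
  have c0 y : 2 * r <= `|y| -> cutoff r y = 0.
    by move=> H; rewrite /cutoff max_r ?subr_le0// expr0n.
  have x1 : `|x| - `|h *: ebase i : 'rV[R]_N| <= `|x + h *: ebase i|.
    by rewrite lerBlDr -{1}(addrK (h *: ebase i) x) ler_normB.
  have x2 : `|x| - `|h *: ebase i : 'rV[R]_N| <= `|x - h *: ebase i|.
    by rewrite lerBlDr -{1}(subrK (h *: ebase i) x) ler_normD.
  by rewrite !c0 ?addr0 ?subrr//; lra.
rewrite indicE mem_set ?mulr1; last by rewrite /cball /= subr0.
have [j xj] := rV_norm_coord x N0.
have le_chi y : cutoff r y <= chi (2 * r) (y ord0 j).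
  apply: lerXn2r; [by rewrite nnegrE le_max lexx orbT|by rewrite nnegrE le_max lexx orbT|].
  by rewrite ge_max !le_max lexx orbT andbT lerB// coord_le_norm.
have cx : cutoff r x = chi (2 * r) (x ord0 j) by rewrite /cutoff xj.
have [b [b1 bh]] : exists b : R, b ^+ 2 <= h ^+ 2 /\ (h *: ebase i : 'rV[R]_N) ord0 j = b.
  exists ((h *: ebase i : 'rV[R]_N) ord0 j); split => //.
  by rewrite !mxE eqxx /=; case: (_ == _); rewrite ?mulr1 ?mulr0// expr0n sqr_ge0.
have := le_chi (x + h *: ebase i); have := le_chi (x - h *: ebase i).
have := chi_second_difference (2 * r) (x ord0 j) b.
by rewrite cx !mxE -bh !mxE in b1 *; lra.
Qed.

Lemma cutoff_ge0 r x : 0 <= cutoff r x.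
Proof. by rewrite sqr_ge0. Qed.

Lemma cutoff_le r x : 0 < r -> cutoff r x <= 4 * r ^+ 2 * \1_(cball 0 (2 * r)) x.
Proof.
move=> r0; have [xr|xr] := leP `|x| (2 * r).
  rewrite indicE mem_set ?mulr1; last by rewrite /cball /= subr0.
  rewrite (_ : 4 * r ^+ 2 = (2 * r) ^+ 2); last by ring.
  rewrite /cutoff lerXn2r ?nnegrE ?le_max ?lexx ?orbT ?mulr_ge0 ?(ltW r0)//.
  by rewrite ge_max mulr_ge0 ?(ltW r0)// andbT gerBl.
rewrite indicE memNset ?mulr0; last by rewrite /cball /= subr0 => /(lt_le_trans xr); rewrite ltxx.
by rewrite /cutoff max_r ?expr0n// subr_le0 ltW.
Qed.

Lemma cutoff_ge r x : 0 < r -> r ^+ 2 * \1_(cball 0 r) x <= cutoff r x.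
Proof.
move=> r0; have [xr|xr] := leP `|x| r.
  rewrite indicE mem_set ?mulr1; last by rewrite /cball /= subr0.
  rewrite /cutoff lerXn2r ?nnegrE ?le_max ?lexx ?orbT ?(ltW r0)//.
  by apply/orP; left; lra.
rewrite indicE memNset ?mulr0 ?cutoff_ge0//.
by rewrite /cball /= subr0 => /(lt_le_trans xr); rewrite ltxx.
Qed.

Lemma bounded_local_cutoff r : 0 < r -> bounded_local (cutoff r).
Proof.
move=> r0; split.
- apply: measurable_funX; apply: measurable_maxr => //.
  apply: measurable_funB => //.
  apply: measurable_superlevel => // c c0.
  rewrite (_ : mkset _ = ~` cball 0 c); first exact: measurableC (measurable_cball _ _).
  by apply/seteqP; split => x; rewrite /cball /= subr0 ltNge => /negP.
- exists (4 * r ^+ 2) => x; rewrite ger0_norm ?cutoff_ge0// (le_trans (cutoff_le _ r0))//.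
  by apply: ler_piMr; [rewrite mulr_ge0 ?sqr_ge0|rewrite indicE lern1 leq_b1].
exists (2 * r) => x xr; apply/eqP; rewrite eq_le cutoff_ge0 andbT (le_trans (cutoff_le _ r0))//.
rewrite indicE memNset ?mulr0//.
by rewrite /cball /= subr0 => /(lt_le_trans xr); rewrite ltxx.
Qed.

End cutoff.

(** * Inner regularity and pointwise bounds *)

Section regularity.
Context {R : realType} {N : nat}.
Local Notation mu := (lebesgue_rV N : {measure set 'rV[R]_N -> \bar R}).

Lemma open_inner_regular (U : set 'rV[R]_N) e :
  open U -> (mu U < +oo)%E -> 0 < e ->
  exists K : set 'rV[R]_N, [/\ compact K, measurable K, K `<=` U & (mu (U `\` K) <= e%:E)%E].
Proof.
move=> oU Uoo e0; have [C [HC UE]] := open_sigma_compact oU.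
pose D n := \big[setU/set0]_(i < n.+1) C i.
have mD n : measurable (D n) by apply: bigsetU_measurable => i _; have [] := HC i.
have mU : measurable U by exact: open_measurable_rV.
have cv : mu \o (fun n => U `\` D n) @ \oo --> mu (\bigcap_n (U `\` D n)).
  apply: nonincreasing_cvg_mu.
  - by apply: le_lt_trans Uoo; apply: le_measure; rewrite ?inE//; exact: measurableD.
  - by move=> n; exact: measurableD.
  - by apply: bigcapT_measurable => n; exact: measurableD.
  move=> n m nm; apply/subsetPset; apply: setDS.
  exact: subset_bigsetU.
have E0 : mu (\bigcap_n (U `\` D n)) = 0%E.
  rewrite (_ : \bigcap_n _ = set0) ?measure0//.
  apply/seteqP; split => // x H.
  have [Ux _] := H 0%N Logic.I.
  have : (\bigcup_k D k) x by rewrite bigcup_bigsetU_bigcup -UE.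
  by move=> [k _ Dk]; have [] := H k Logic.I.
rewrite E0 in cv.
have /cv : nbhs (0%E : \bar R) [set y | (y < e%:E)%E].
  by apply: open_nbhs_nbhs; split; [exact: open_ereal_lt_ereal|rewrite /= lte_fin].
move=> [n _ /(_ n (leqnn n)) /= Hn].
exists (D n); split => //.
- by apply: bigsetU_compact => i _; have [] := HC i.
- rewrite UE /D -bigcup_mkord => x [i _ Cx]; by exists i.
exact: ltW.
Qed.

(** An essential bound of a continuous function holds everywhere, since every
    neighbourhood of a point of the parabolic cylinder meets it in a set of
    positive measure. *)
Lemma Linfty_bounded (Omega : set 'rV[R]_N) T (f : 'rV[R]_N * R -> R) :
  open Omega -> {within Omega `*` `]0, T], continuous f} ->
  Linfty (lebesgue_rV N \x lebesgue_measure)%E (Omega `*` `]0, T]) f ->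
  exists2 B, 0 <= B & forall z, (Omega `*` `]0, T]) z -> `|f z| <= B.
Proof.
set Q := _ `*` _; move=> oO cf.
rewrite /Linfty /Lfun => /andP[_].
rewrite inE /= /finite_norm unlock.
set P := (_ \x _)%E.
have pos z d : Q z -> 0 < d ->
    exists A, [/\ measurable A, A `<=` Q, A `<=` ball z d & (0 < P A)%E].
  case: z => x t [/= Ox tT] d0.
  have /nbhs_ballP[d1 /= d10 Hd1] : nbhs x Omega by exact: open_nbhs_nbhs.
  move: tT; rewrite in_itv /= => /andP[t0 tT].
  pose d2 := Num.min (d / 2) (Num.min d1 (t / 2)).
  have d20 : 0 < d2 by rewrite !lt_min d10 !divr_gt0.
  have d2d : d2 <= d / 2 by rewrite ge_min lexx.
  have d2d1 : d2 <= d1 by rewrite !ge_min lexx orbT.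
  have d2t : d2 <= t / 2 by rewrite !ge_min lexx !orbT.
  (* The box extends backwards in time only, which also serves for [t = T]. *)
  exists (ball x d2 `*` `]t - d2, t]%classic); split.
  - by apply: measurableX; [apply: open_measurable_rV; exact: ball_open|exact: measurable_itv].
  - move=> [y s] [/= yx]; rewrite in_itv /= => /andP[ts st]; split => /=.
      by apply: Hd1; exact: le_ball yx.
    by rewrite in_itv /=; apply/andP; split; lra.
  - move=> [y s] [/= yx]; rewrite in_itv /= => /andP[ts st]; split => /=.
      by apply: le_ball yx; lra.
    by rewrite /ball /= ltr_norml; apply/andP; split; lra.
  rewrite /P product_measure1E//; last by apply: open_measurable_rV; exact: ball_open.
  apply: mule_gt0; first exact: lebesgue_ball_gt0.
  have := @lebesgue_measure_itv R `](t - d2), t]; rewrite /= lte_fin ifT; last by lra.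
  by move=> ->; rewrite -EFinD lte_fin; lra.
have [|Q0] := pselect (Q !=set0); last first.
  by exists 0 => // z Qz; exfalso; apply: Q0; exists z.
move=> [z0 Qz0].
have PT : (0 < P setT)%E.
  have [A [mA _ _ A0]] := pos z0 1 Qz0 ltr01.
  by apply: lt_le_trans A0 _; apply: le_measure; rewrite ?inE.
rewrite PT => essf.
have [M HM] : exists M : R, {ae P, forall z, `|(f \_ Q) z| <= M}.
  have := ess_sup_ge P (abse \o (EFin \o f \_ Q)).
  move: essf; case: (ess_sup _ _) => [M|//|] _ H.
    by exists M; apply: filterS H => z /=; rewrite lee_fin.
  by exists 0; apply: filterS H => z /=; rewrite leeNy_eq.
exists (Num.max M 0); first by rewrite le_max lexx orbT.
move=> z Qz; rewrite leNgt; apply/negP; rewrite gt_max => /andP[Mz _].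
have e0 : 0 < `|f z| - M by rewrite subr_gt0.
have [d d0 Hd] := within_continuous_ball cf Qz e0.
have [A [mA AQ Ab A0]] := pos z d Qz d0.
move: HM => [Z [mZ Z0 HZ]].
suff : (P A <= 0)%E by rewrite leNgt A0.
rewrite -Z0; apply: le_measure; rewrite ?inE//.
move=> y Ay; apply: HZ => /=; rewrite patchE mem_set; last exact: AQ.
apply/negP; rewrite -ltNge.
have := Hd y (AQ _ Ay) (Ab _ Ay); have := ler_dist_dist (f y) (f z).
have := lerNnormlW (lexx `| `|f y| - `|f z| |); lra.
Qed.

End regularity.

(** * The positive parts of the differences *)

Lemma kato_space_arith (R : realFieldType) (A B C D e h : R) :
  - (h * (e / 4)) <= A - h * C -> B - h * D <= h * (e / 4) ->
  h * (C - D - e / 2) <= A - B.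
Proof. by move=> *; lra. Qed.

Lemma kato_time_arith (R : realFieldType) (a b c d p q C D k e S : R) : 0 < k ->
  a - b - k * p <= k * (e / 4) -> - (k * (e / 4)) <= c - d - k * q ->
  p - C <= q - D -> C - D - e / 2 <= S ->
  a - c - (b - d) <= k * (S + e).
Proof.
move=> k0 H1 H2 H3 H4.
have : 0 <= k * (S - (C - D - e / 2)) by rewrite mulr_ge0 ?subr_ge0// ltW.
have : 0 <= k * (q - D - (p - C)) by rewrite mulr_ge0 ?subr_ge0// ltW.
by move: H1 H2; clear; lra.
Qed.

Section comparison.
Context {R : realType} {N : nat}.
Variables (phi : R -> R) (delta1 delta2 : R).
Hypotheses (hphi : C2 phi) (hdelta1 : 0 < delta1)
  (hphi' : forall s, delta1 <= derive1 phi s <= delta2).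
Variables (T : R) (Omega : set 'rV[R]_N) (u v : 'rV[R]_N * R -> R).
Hypotheses (oOmega : open Omega) (hu : C21 Omega T u) (hv : C21 Omega T v).
Local Notation Q := (Omega `*` `]0, T]).
Local Notation Qbar := (closure Omega `*` `]0, T]).
Hypotheses (hu_cont : {within Qbar, continuous u})
  (hv_cont : {within Qbar, continuous v}).
Hypothesis hpde : forall z, Q z ->
  dt T u z - laplacian (phi \o u) z <= dt T v z - laplacian (phi \o v) z.
Hypothesis hbdry : forall z, (boundary Omega `*` `]0, T]) z -> u z <= v z.
Local Notation e_ i := (@ebase R N i).
Local Notation w z := (u z - v z).
Local Notation W z := (phi (u z) - phi (v z)).

Definition wplus (s : R) : 'rV[R]_N -> R :=
  (fun x => Num.max (u (x, s) - v (x, s)) 0) \_ Omega.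

Definition Wplus (s : R) : 'rV[R]_N -> R :=
  (fun x => Num.max (phi (u (x, s)) - phi (v (x, s))) 0) \_ Omega.

Lemma phi_increment a b : a <= b ->
  delta1 * (b - a) <= phi b - phi a <= delta2 * (b - a).
Proof.
move=> ab; have [d1 _ _] := hphi.
have dphi s : is_derive s (1 : R) phi (derive1 phi s).
  by split; [exact: d1|rewrite derive1E].
have cphi : {within `[a, b], continuous phi}.
  by apply: derivable_within_continuous => s _; exact: d1.
have [c _ ->] := MVT_segment ab (fun s _ => dphi s) cphi.
by have /andP[? ?] := hphi' c; rewrite !ler_wpM2r ?subr_ge0.
Qed.

Lemma W_ge_w z : 0 <= w z -> delta1 * w z <= W z <= delta2 * w z.
Proof. rewrite subr_ge0; exact: phi_increment. Qed.

Lemma W_gt0 z : 0 < W z -> 0 < w z.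
Proof.
rewrite !subr_gt0 => H; rewrite ltNge; apply/negP => uv.
have /andP[+ _] := phi_increment uv.
have : 0 <= delta1 * (v z - u z) by rewrite mulr_ge0 ?subr_ge0// ltW.
by move: H; set a := phi _; set b := phi _; lra.
Qed.

Lemma wplus_ge0 s x : 0 <= wplus s x.
Proof. by rewrite /wplus patchE; case: ifP => // _; rewrite le_max lexx orbT. Qed.

Lemma Wplus_ge0 s x : 0 <= Wplus s x.
Proof. by rewrite /Wplus patchE; case: ifP => // _; rewrite le_max lexx orbT. Qed.

Lemma wplusE s x : Omega x -> wplus s x = Num.max (w (x, s)) 0.
Proof. by move=> Ox; rewrite /wplus patchE mem_set. Qed.

Lemma WplusE s x : Omega x -> Wplus s x = Num.max (W (x, s)) 0.
Proof. by move=> Ox; rewrite /Wplus patchE mem_set. Qed.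

Lemma Wplus_le s x : Wplus s x <= delta2 * wplus s x.
Proof.
rewrite /Wplus /wplus !patchE; case: ifP => [_|_]; last by rewrite mulr0.
have d2 : 0 <= delta2 by have /andP[a b] := hphi' 0; rewrite (le_trans (ltW hdelta1))// (le_trans a b).
rewrite ge_max; apply/andP; split; last by rewrite mulr_ge0// le_max lexx orbT.
have [w0|w0] := leP 0 (w (x, s)); last first.
  rewrite mulr0 leNgt; apply/negP => /W_gt0.
  by rewrite ltNge (ltW w0).
by have /andP[_] := W_ge_w w0.
Qed.

(** Where [w] is positive at time [s], the positive part of [w] at time [s - k] is
    at least [w] there, and likewise for [W] at the neighbouring points, so that
    the differential inequality passes to differences.  Where [w] is nonpositive,
    the left-hand side is nonpositive and the second differences of [Wplus] are
    nonnegative. *)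
Lemma discrete_kato (K : set 'rV[R]_N) tau e :
  compact K -> K `<=` Omega -> 0 < tau -> tau <= T -> 0 < e ->
  exists2 d, 0 < d & forall h k x s, 0 < h < d -> 0 < k < d -> K x ->
    tau + k <= s <= T ->
    wplus s x - wplus (s - k) x <=
      k * (h ^- 2 * \sum_i (Wplus s (x + h *: e_ i) + Wplus s (x - h *: e_ i)
                            - Wplus s x *+ 2) + e).
Proof.
move=> cK KO tau0 tauT e0.
have e4 : 0 < e / 4 by rewrite divr_gt0.
have [d1 d10 Hd1] := time_increment hu cK KO tau0 e4.
have [d2 d20 Hd2] := time_increment hv cK KO tau0 e4.
have [d3 d30 Hd3] := laplacian_increment hphi oOmega hu cK KO tau0 e4.
have [d4 d40 Hd4] := laplacian_increment hphi oOmega hv cK KO tau0 e4.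
exists (Num.min (Num.min d1 d2) (Num.min d3 d4)); first by rewrite !lt_min d10 d20 d30 d40.
move=> h k x s /andP[h0 +] /andP[k0 +] Kx /andP[ts sT].
rewrite !lt_min => /andP[_ /andP[hd3 hd4]] /andP[/andP[kd1 kd2] _].
have Ox := KO _ Kx.
have h20 : 0 < h ^+ 2 by rewrite exprn_gt0.
have [w0|w0] := leP (w (x, s)) 0.
  have -> : wplus s x = 0 by rewrite wplusE// max_r.
  have -> : Wplus s x = 0.
    by rewrite WplusE// max_r// leNgt; apply/negP => /W_gt0; rewrite ltNge w0.
  rewrite mul0rn (@le_trans _ _ 0)// ?sub0r ?oppr_le0 ?wplus_ge0//.
  rewrite mulr_ge0 ?(ltW k0)// addr_ge0 ?(ltW e0)// mulr_ge0 ?invr_ge0 ?(ltW h20)//.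
  by apply: sumr_ge0 => i _; rewrite subr0 addr_ge0 ?Wplus_ge0.
have tk : tau + k <= s <= T by rewrite ts.
have ts' : tau <= s <= T by rewrite sT andbT (le_trans _ ts)// lerDl ltW.
have hd3' : 0 < h < d3 by rewrite h0.
have hd4' : 0 < h < d4 by rewrite h0.
have kd1' : 0 < k < d1 by rewrite k0.
have kd2' : 0 < k < d2 by rewrite k0.
have tu0 := Hd1 _ _ _ kd1' Kx tk.
have tv0 := Hd2 _ _ _ kd2' Kx tk.
have [Oh lu] := Hd3 _ _ _ hd3' Kx ts'.
have [_ lv] := Hd4 _ _ _ hd4' Kx ts'.
have Qxs : Q (x, s).
  by split => //=; rewrite in_itv /= sT andbT (lt_le_trans tau0)//; case/andP: ts'.
have pde := hpde Qxs.
have W0 : 0 <= W (x, s).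
  have /andP[+ _] := W_ge_w (ltW w0); apply: le_trans.
  by rewrite mulr_ge0// ltW.
pose S := \sum_i (Wplus s (x + h *: e_ i) + Wplus s (x - h *: e_ i) - Wplus s x *+ 2).
have HS : h ^+ 2 * (laplacian (phi \o u) (x, s) - laplacian (phi \o v) (x, s) - e / 2) <= S.
  apply: (@le_trans _ _ (\sum_i (phi (u (x + h *: e_ i, s)) + phi (u (x - h *: e_ i, s)) - phi (u (x, s)) *+ 2)
      - \sum_i (phi (v (x + h *: e_ i, s)) + phi (v (x - h *: e_ i, s)) - phi (v (x, s)) *+ 2))).
    exact: kato_space_arith (lerNnormlW lu) (ler_normlW lv).
  rewrite -sumrB; apply: ler_sum => i _.
  have [om1 om2] := Oh i; rewrite !WplusE// (max_l W0).
  apply: (@le_trans _ _ (W (x + h *: e_ i, s) + W (x - h *: e_ i, s) - W (x, s) *+ 2)).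
    by rewrite !mulr2n le_eqVlt; apply/orP; left; apply/eqP; ring.
  by rewrite lerB// lerD// le_max lexx.
have HS' : laplacian (phi \o u) (x, s) - laplacian (phi \o v) (x, s) - e / 2 <= h ^- 2 * S.
  by rewrite [leRHS]mulrC ler_pdivlMr// [leLHS]mulrC.
rewrite wplusE// (max_l (ltW w0)) wplusE//.
apply: (@le_trans _ _ (w (x, s) - w (x, s - k))); first by rewrite lerB// le_max lexx.
exact: (kato_time_arith k0 (ler_normlW tu0) (lerNnormlW tv0) pde HS').
Qed.

Lemma within_continuous_w : {within Qbar, continuous (fun z => w z)}.
Proof.
apply/subspace_continuousP => z Qz.
have FF : Filter (within Qbar (nbhs z)) by exact: within_filter.
move/subspace_continuousP : hu_cont => /(_ _ Qz) cu.
move/subspace_continuousP : hv_cont => /(_ _ Qz) cv.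
exact: cvgB cu cv.
Qed.

Lemma within_continuous_W : {within Qbar, continuous (fun z => W z)}.
Proof.
have cphi s : {for s, continuous phi}.
  have [d1 _ _] := hphi.
  by apply: differentiable_continuous; apply/derivable1_diffP; exact: d1.
apply/subspace_continuousP => z Qz.
have FF : Filter (within Qbar (nbhs z)) by exact: within_filter.
move/subspace_continuousP : hu_cont => /(_ _ Qz) cu.
move/subspace_continuousP : hv_cont => /(_ _ Qz) cv.
exact: cvgB (cvg_comp u _ cu (cphi _)) (cvg_comp v _ cv (cphi _)).
Qed.

Lemma Q_sub_Qbar : Q `<=` Qbar.
Proof. by move=> z [Oz Tz]; split => //; exact: subset_closure. Qed.

Lemma positive_inside z : Qbar z -> 0 < W z -> Q z.
Proof.
move=> [Oz Tz] /W_gt0 w0; split => //; apply: contrapT => nOz.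
have : u z <= v z.
  by apply: hbdry; split => //; split => //; rewrite (interior_id _).1.
by move: w0; rewrite subr_gt0 leNgt => ->.
Qed.

Let compact_slab r tau t : 0 < tau -> t <= T ->
  compact ((cball 0 r `&` closure Omega) `*` `[tau, t]) /\
  (cball 0 r `&` closure Omega) `*` `[tau, t] `<=` Qbar.
Proof.
move=> tau0 tT; split.
  apply: compact_setX; last exact: segment_compact.
  by apply: compact_closedI; [exact: compact_cball|exact: closed_closure].
move=> [x s] [/= [_ Ox]]; rewrite in_itv /= => /andP[ts st]; split => //=.
by rewrite in_itv /= (lt_le_trans tau0)// (le_trans st).
Qed.

(** The set where [W >= c] stays away from the boundary of [Omega], uniformly for
    times bounded away from 0; this is where the boundary inequality is used. *)
Lemma superlevel_inside r tau c : 0 < tau -> 0 < c ->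
  exists2 K, compact K /\ K `<=` Omega &
    forall x s, `|x| <= r -> tau <= s <= T -> c <= Wplus s x -> K x.
Proof.
move=> tau0 c0; have [cA AQ] := compact_slab r tau0 (lexx T).
pose S := [set z | ((cball 0 r `&` closure Omega) `*` `[tau, T]) z /\ c <= W z].
have cS : compact S.
  apply: compact_superlevel cA.
  exact: continuous_subspaceW AQ within_continuous_W.
exists (fst @` S).
  split.
    apply: continuous_compact cS; apply: continuous_subspaceT => z; exact: cvg_fst.
  by move=> _ [z [Az Wz] <-]; have [] := positive_inside (AQ _ Az) (lt_le_trans c0 Wz).
move=> x s xr ts; rewrite /Wplus patchE; case: ifPn => [/set_mem Ox|_].
  rewrite le_max => /orP[cW|]; last by rewrite leNgt c0.
  exists (x, s) => //; split => //=; split => /=; last by rewrite in_itv.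
  by split; [rewrite /cball /= subr0|exact: subset_closure].
by rewrite leNgt c0.
Qed.

(** Where [wplus t] is at least [c], the integral of [Wplus] up to time [t] is
    bounded below; [kappa] is uniform on bounded sets, although [Omega] is not
    closed, because [W >= delta1 * c] describes a compact subset of its closure. *)
Lemma positive_persists r t c : 0 < t <= T -> 0 < c ->
  exists2 kappa, 0 < kappa & forall x s, `|x| <= r -> c <= wplus t x ->
    0 < s -> t - kappa <= s <= t -> delta1 * c / 2 <= Wplus s x.
Proof.
move=> /andP[t0 tT] c0; have [cA AQ] := compact_slab r t0 tT.
pose S := [set z | ((cball 0 r `&` closure Omega) `*` `[t, t]) z /\ delta1 * c <= W z].
have cS : compact S.
  apply: compact_superlevel cA.
  exact: continuous_subspaceW AQ within_continuous_W.
have SQ : S `<=` Qbar by move=> z [/AQ].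
have e0 : 0 < delta1 * c / 2 by rewrite divr_gt0// mulr_gt0.
have [d d0 H] := within_continuous_unif within_continuous_W cS SQ e0.
exists (d / 2); first by rewrite divr_gt0.
move=> x s xr; rewrite /wplus patchE; case: ifPn => [/set_mem Ox|_]; last by rewrite leNgt c0.
rewrite le_max => /orP[cw|]; last by rewrite leNgt c0.
move=> s0 /andP[ts st].
have Wxt : delta1 * c <= W (x, t).
  have /andP[+ _] := W_ge_w (le_trans (ltW c0) cw); apply: le_trans.
  by rewrite ler_wpM2l// ltW.
have Sxt : S (x, t).
  split => //; split => /=; last by rewrite in_itv /= lexx.
  by split; [rewrite /cball /= subr0|exact: subset_closure].
have Qs : Qbar (x, s).
  by split => /=; [exact: subset_closure|rewrite in_itv /= s0 (le_trans st)].
have bts : ball (x, t) d (x, s).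
  split => /=; first exact: ballxx.
  by rewrite /ball /= ger0_norm ?subr_ge0//; lra.
have := lerNnormlW (H _ _ Sxt Qs bts).
rewrite WplusE// le_max => H1; apply/orP; left.
have {}H1 : W (x, t) - delta1 * c / 2 <= W (x, s) by lra.
apply: le_trans H1; lra.
Qed.

Lemma open_slice_superlevel (g : 'rV[R]_N * R -> R) s c :
  {within Q, continuous g} -> 0 < s <= T -> open [set x | Omega x /\ c < g (x, s)].
Proof.
move=> cg sT; rewrite openE => x /= [Ox cgx].
have Qx : Q (x, s) by split.
have e0 : 0 < g (x, s) - c by rewrite subr_gt0.
have [d d0 H] := within_continuous_ball cg Qx e0.
have nO : nbhs x Omega by exact: open_nbhs_nbhs.
rewrite /interior /=; near=> y.
have Oy : Omega y by near: y.
have yb : ball x d y by near: y; exact: nbhsx_ballx.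
have Qy : Q (y, s) by split.
have bxy : ball (x, s) d (y, s) by split => //=; exact: ballxx.
split => //; have := H _ Qy bxy.
by rewrite ltr_norml => /andP[]; lra.
Unshelve. all: by end_near. Qed.

Let measurable_pos_part (g : 'rV[R]_N * R -> R) s :
  {within Q, continuous g} -> 0 < s <= T ->
  measurable_fun setT ((fun x => Num.max (g (x, s)) 0) \_ Omega : 'rV[R]_N -> R).
Proof.
move=> cg sT; apply: measurable_superlevel => [x|c c0].
  by rewrite patchE; case: ifP => // _; rewrite le_max lexx orbT.
rewrite (_ : mkset _ = [set x | Omega x /\ c < g (x, s)]).
  exact: open_measurable_rV (open_slice_superlevel cg sT).
apply/seteqP; split => x /=; rewrite patchE; case: ifPn.
- by move=> /set_mem Ox; rewrite lt_max => /orP[//|]; rewrite ltNge c0.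
- by rewrite ltNge c0.
- by move=> _ [_ ?]; rewrite lt_max; apply/orP; left.
by move=> /negP nO [Ox _]; exfalso; apply: nO; exact: mem_set.
Qed.

Lemma measurable_wplus s : 0 < s <= T -> measurable_fun setT (wplus s).
Proof.
apply: (@measurable_pos_part (fun z => w z)).
exact: continuous_subspaceW Q_sub_Qbar within_continuous_w.
Qed.

Lemma measurable_Wplus s : 0 < s <= T -> measurable_fun setT (Wplus s).
Proof.
apply: (@measurable_pos_part (fun z => W z)).
exact: continuous_subspaceW Q_sub_Qbar within_continuous_W.
Qed.

(** ** Time integration by Riemann sums *)

Definition riemann tau k m (x : 'rV[R]_N) : R :=
  k * \sum_(0 <= j < m) Wplus (tau + j.+1%:R * k) x.

Lemma riemann_ge0 tau k m x : 0 <= k -> 0 <= riemann tau k m x.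
Proof. by move=> k0; rewrite mulr_ge0// sumr_ge0// => j _; exact: Wplus_ge0. Qed.

Let positive_cover r tau t c : 0 < tau -> tau < t <= T -> 0 < c ->
  exists2 delta, 0 < delta & forall k m x, 0 < k -> k * m%:R = t - tau ->
    `|x| <= r -> c <= wplus t x -> delta < riemann tau k m x.
Proof.
move=> tau0 /andP[taut tT] c0.
have t0 : 0 < t <= T by rewrite (lt_trans tau0).
have [kap' kap'0 Hkap'] := positive_persists r t0 c0.
pose kap := Num.min kap' (t - tau).
have kap0 : 0 < kap by rewrite lt_min kap'0 subr_gt0.
have kapk : kap <= kap' by rewrite ge_min lexx.
have kapt : kap <= t - tau by rewrite ge_min lexx orbT.
pose c' := delta1 * c / 2.
have c'0 : 0 < c' by rewrite divr_gt0// mulr_gt0.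
exists (kap * c' / 2); first by rewrite divr_gt0// mulr_gt0.
move=> k m x k0 km xr cx.
have q0 : 0 <= (t - kap - tau) / k by rewrite divr_ge0 ?(ltW k0)//; lra.
(* [tau + p * k] is the last partition point up to [t - kap]. *)
have /andP[pq qp] := truncn_itv q0.
set p := Num.trunc _ in pq qp.
have pk : p%:R * k <= t - kap - tau by rewrite -ler_pdivlMr.
have kp : t - kap - tau < p.+1%:R * k by rewrite -ltr_pdivrMr.
have pm : (p <= m)%N.
  rewrite -(ler_nat R) -(ler_pM2r k0) (le_trans pk)// mulrC km.
  by lra.
rewrite /riemann (big_cat_nat (n := p))//= mulrDr.
have h1 : 0 <= k * \sum_(0 <= j < p) Wplus (tau + j.+1%:R * k) x.
  by rewrite mulr_ge0 ?(ltW k0)// sumr_ge0// => j _; exact: Wplus_ge0.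
have h2 : k * \sum_(p <= j < m) c' <= k * \sum_(p <= j < m) Wplus (tau + j.+1%:R * k) x.
  rewrite ler_wpM2l ?(ltW k0)// [leLHS]big_nat [leRHS]big_nat; apply: ler_sum => j /andP[pj jm].
  apply: Hkap' => //.
    by rewrite addr_gt0// mulr_gt0// ltr0n.
  have : p.+1%:R * k <= j.+1%:R * k by rewrite ler_wpM2r ?(ltW k0)// ler_nat.
  have : j.+1%:R * k <= m%:R * k by rewrite ler_wpM2r ?(ltW k0)// ler_nat.
  by rewrite [m%:R * k]mulrC km; move: kp kapk; set a := _ * k; set b := _ * k => *; apply/andP; split; lra.
have h3 : kap * c' <= k * \sum_(p <= j < m) c'.
  rewrite sumr_const_nat -mulr_natr [k * _]mulrCA [kap * c']mulrC ler_wpM2l ?(ltW c'0)//.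
  by rewrite natrB// mulrBr km mulrC [leRHS]addrC -lerBlDr; move: pk; rewrite mulrC; lra.
have h4 : 0 < kap * c' by rewrite mulr_gt0.
lra.
Qed.

(** [F] is the truncated time integral of [Wplus].  Where it is positive, the point
    lies in a compact subset of [Omega], on which [discrete_kato] holds at all
    partition times and is summed, the left-hand sides telescoping; passing from
    the Riemann sum to [F] only increases the second differences.  Where [F]
    vanishes, [wplus t] is at most [c]. *)
Lemma riemann_pointwise r tau t c e : 0 < r -> 0 < tau -> tau < t <= T -> 0 < c -> 0 < e ->
  exists h k m delta, [/\ 0 < h <= r, 0 < k, k * m%:R = t - tau, 0 < delta &
    let F x := Num.max (riemann tau k m x - delta) 0 in
    forall x, `|x| <= 2 * r ->
      wplus t x <= c + e + wplus tau x +
        h ^- 2 * \sum_i (F (x + h *: e_ i) + F (x - h *: e_ i) - F x *+ 2)].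
Proof.
move=> r0 tau0 taut c0 e0.
have [delta delta0 Hdelta] := positive_cover (2 * r) tau0 taut c0.
move: (taut) => /andP[tt tT].
have tt0 : 0 < t - tau by rewrite subr_gt0.
have T0 : 0 < T by rewrite (lt_le_trans _ tT)// (lt_trans tau0).
(* If the Riemann sum exceeds [delta], one of its terms exceeds this level. *)
have l0 : 0 < delta / (t - tau) by rewrite divr_gt0.
have [K [cK KO] HK] := superlevel_inside (2 * r) tau0 l0.
have eT0 : 0 < e / T by rewrite divr_gt0.
have tauT : tau <= T by rewrite (le_trans (ltW tt)).
have [d d0 Hd] := discrete_kato cK KO tau0 tauT eT0.
(* The step [k] is fixed last: [delta] and the compact set [K] do not depend on
   the partition. *)
have [m Hm] : exists m, 0 + m.+1%:R^-1 < d / (t - tau).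
  by apply: ltr_add_invr; rewrite divr_gt0.
pose k := (t - tau) / m.+1%:R.
have k0 : 0 < k by rewrite divr_gt0.
have kd : k < d by move: Hm; rewrite add0r ltr_pdivlMr// mulrC.
have km : k * m.+1%:R = t - tau by rewrite divfK.
exists (Num.min (d / 2) r), k, m.+1, delta.
set h := Num.min _ _.
have h0 : 0 < h by rewrite lt_min r0 divr_gt0.
have hd : h < d by rewrite gt_min; apply/orP; left; lra.
have hr : h <= r by rewrite ge_min lexx orbT.
split => //; first by rewrite h0.
move=> F x xr.
have F0 y : 0 <= F y by rewrite le_max lexx orbT.
have [Zd|Zd] := leP (riemann tau k m.+1 x) delta.
  have xc : wplus t x <= c.
    by apply: ltW; rewrite ltNge; apply/negP => /(Hdelta _ _ _ k0 km xr); rewrite ltNge Zd.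
  have Fx : F x = 0 by rewrite /F max_r// subr_le0.
  rewrite -[leLHS]addr0 -[leLHS]addr0 !lerD ?wplus_ge0 ?(ltW e0)//.
    by rewrite -[leLHS]addr0 lerD ?(ltW e0).
  rewrite mulr_ge0 ?invr_ge0 ?exprn_ge0 ?(ltW h0)//.
  by apply: sumr_ge0 => i _; rewrite Fx mul0rn subr0 addr_ge0.
have sT j : (j <= m)%N -> tau + k <= tau + j.+1%:R * k <= T.
  move=> jm; rewrite lerD2l ler_peMl ?(ltW k0) ?ler1n//=.
  have : j.+1%:R * k <= m.+1%:R * k by rewrite ler_wpM2r ?(ltW k0)// ler_nat.
  by rewrite [m.+1%:R * _]mulrC km => H; rewrite -lerBrDl (le_trans H)// lerB.
have Kx : K x.
  apply: contrapT => nKx; move: Zd; apply/negP; rewrite -leNgt.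
  apply: (@le_trans _ _ (k * \sum_(0 <= j < m.+1) (delta / (t - tau)))).
    rewrite ler_wpM2l ?(ltW k0)// [leLHS]big_nat [leRHS]big_nat; apply: ler_sum => j /andP[_ jm].
    rewrite leNgt; apply/negP => H; apply: nKx; apply: HK xr _ (ltW H).
    by have /andP[H1 ->] := sT j jm; rewrite (le_trans _ H1)// lerDl ltW.
  by rewrite sumr_const_nat subn0 -mulr_natr mulrCA km divfK// gt_eqF.
have step j : (j <= m)%N ->
   wplus (tau + j.+1%:R * k) x - wplus (tau + j%:R * k) x <=
   k * (h ^- 2 * \sum_i (Wplus (tau + j.+1%:R * k) (x + h *: e_ i)
     + Wplus (tau + j.+1%:R * k) (x - h *: e_ i)
     - Wplus (tau + j.+1%:R * k) x *+ 2) + e / T).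
  move=> jm; have := Hd h k x (tau + j.+1%:R * k); rewrite h0 k0 /= => /(_ hd kd Kx (sT j jm)).
  by rewrite (_ : tau + j.+1%:R * k - k = tau + j%:R * k)// -natr1; ring.
have tele : wplus t x - wplus tau x <= \sum_(0 <= j < m.+1)
   k * (h ^- 2 * \sum_i (Wplus (tau + j.+1%:R * k) (x + h *: e_ i)
     + Wplus (tau + j.+1%:R * k) (x - h *: e_ i)
     - Wplus (tau + j.+1%:R * k) x *+ 2) + e / T).
  have -> : wplus t x - wplus tau x = \sum_(0 <= j < m.+1)
      (wplus (tau + j.+1%:R * k) x - wplus (tau + j%:R * k) x).
    rewrite (telescope_sumr (fun j => wplus (tau + j%:R * k) x))// mul0r addr0.
    by rewrite [_ * k]mulrC km [tau + _]addrC subrK.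
  rewrite [leLHS]big_nat [leRHS]big_nat; apply: ler_sum => j /andP[_ jm]; exact: step.
have sumE : \sum_(0 <= j < m.+1)
   k * (h ^- 2 * \sum_i (Wplus (tau + j.+1%:R * k) (x + h *: e_ i)
     + Wplus (tau + j.+1%:R * k) (x - h *: e_ i)
     - Wplus (tau + j.+1%:R * k) x *+ 2) + e / T) =
   h ^- 2 * \sum_i (riemann tau k m.+1 (x + h *: e_ i) + riemann tau k m.+1 (x - h *: e_ i)
     - riemann tau k m.+1 x *+ 2) + (t - tau) * (e / T).
  under eq_bigr do rewrite mulrDr.
  rewrite big_split /= sumr_const_nat subn0; congr (_ + _); last first.
    by rewrite -mulr_natr mulrAC km.
  rewrite -mulr_sumr -mulr_sumr mulrCA exchange_big /=; congr (_ * _).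
  rewrite mulr_sumr; apply: eq_bigr => i _.
  rewrite /riemann -mulrnAr -mulrDr -mulrBr -sumrMnl -big_split /= -sumrB.
  by [].
have Fle : \sum_i (riemann tau k m.+1 (x + h *: e_ i) + riemann tau k m.+1 (x - h *: e_ i)
     - riemann tau k m.+1 x *+ 2) <=
   \sum_i (F (x + h *: e_ i) + F (x - h *: e_ i) - F x *+ 2).
  apply: ler_sum => i _.
  have Fx : F x = riemann tau k m.+1 x - delta by rewrite /F max_l// subr_ge0 ltW.
  have F1 y : riemann tau k m.+1 y - delta <= F y by rewrite /F le_max lexx.
  have := F1 (x + h *: e_ i); have := F1 (x - h *: e_ i); rewrite Fx.
  set a := riemann _ _ _ _; set b := riemann _ _ _ _; set g := riemann _ _ _ _.
  set a' := F _; set b' := F _; rewrite !mulr2n; lra.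
have eT : (t - tau) * (e / T) <= e.
  rewrite mulrCA ler_piMr ?(ltW e0)// ler_pdivrMr// mul1r.
  by rewrite (le_trans _ tT)// gerBl ltW.
have h2 : 0 <= h ^- 2 by rewrite invr_ge0 exprn_ge0// ltW.
have := ler_wpM2l h2 Fle; move: tele; rewrite sumE.
move: eT c0.
set a := wplus t x; set b := wplus tau x; set C := h ^- 2 * _; set D := h ^- 2 * _.
by lra.
Qed.

(** ** The mass of the positive part *)

Variable B : R.
Hypotheses (N_gt0 : (0 < N)%N) (B_ge0 : 0 <= B)
  (hB : forall z, Q z -> `|u z| <= B /\ `|v z| <= B).
Local Notation mu := (lebesgue_rV N : {measure set 'rV[R]_N -> \bar R}).

Definition mass s r : R := \int[mu]_x (\1_(cball 0 r) x * wplus s x).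

Lemma wplus_le s x : 0 < s <= T -> wplus s x <= 2 * B.
Proof.
move=> sT; rewrite /wplus patchE; case: ifPn => [/set_mem Ox|_]; last by rewrite mulr_ge0.
have Qx : Q (x, s) by split.
have [/ler_normlP[u1 u2] /ler_normlP[v1 v2]] := hB Qx.
by rewrite ge_max mulr_ge0// andbT; lra.
Qed.

Let delta2_ge0 : 0 <= delta2.
Proof. by have /andP[a b] := hphi' 0; rewrite (le_trans (ltW hdelta1))// (le_trans a b). Qed.

Lemma Wplus_bnd s x : 0 < s <= T -> Wplus s x <= delta2 * (2 * B).
Proof. by move=> sT; rewrite (le_trans (Wplus_le _ _))// ler_wpM2l// wplus_le. Qed.

Lemma bounded_local_wplus f s : 0 < s <= T -> bounded_local f ->
  bounded_local (fun x => f x * wplus s x).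
Proof.
move=> sT bf; apply: bounded_localM => //; first exact: measurable_wplus.
by exists (2 * B) => x; rewrite ger0_norm ?wplus_ge0// wplus_le.
Qed.

Lemma bounded_local_Wplus f s : 0 < s <= T -> bounded_local f ->
  bounded_local (fun x => f x * Wplus s x).
Proof.
move=> sT bf; apply: bounded_localM => //; first exact: measurable_Wplus.
by exists (delta2 * (2 * B)) => x; rewrite ger0_norm ?Wplus_ge0// Wplus_bnd.
Qed.

Lemma integral_Wplus_le s r : 0 < s <= T ->
  \int[mu]_x (\1_(cball 0 r) x * Wplus s x) <= delta2 * mass s r.
Proof.
move=> sT; have bc := @bounded_local_cball R N r.
rewrite /mass -local_integralZ; last exact: bounded_local_wplus.
apply: local_integral_le.
- exact: bounded_local_Wplus.
- by apply: bounded_localZ; exact: bounded_local_wplus.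
by move=> x; rewrite mulrCA ler_wpM2l// Wplus_le.
Qed.

Lemma mass_ge0 s r : 0 <= mass s r.
Proof. by apply: Rintegral_ge0 => x _; rewrite mulr_ge0// wplus_ge0. Qed.

Lemma mass_le_volume s r : 0 < r -> 0 < s <= T -> mass s r <= 2 * B * (4 * r) ^+ N.
Proof.
move=> r0 sT; have bc := @bounded_local_cball R N r.
apply: (@le_trans _ _ (2 * B * \int[mu]_x (\1_(cball 0 r) x))).
  rewrite -local_integralZ//; apply: local_integral_le.
  - exact: bounded_local_wplus.
  - exact: bounded_localZ.
  by move=> x; rewrite mulrC ler_wpM2r// wplus_le.
by rewrite ler_wpM2l ?mulr_ge0// local_integral_cball_le.
Qed.

Lemma mass_monotone s r r' : r <= r' -> 0 < s <= T -> mass s r <= mass s r'.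
Proof.
move=> rr sT; apply: local_integral_le.
- by apply: bounded_local_wplus => //; exact: bounded_local_cball.
- by apply: bounded_local_wplus => //; exact: bounded_local_cball.
move=> x; rewrite ler_wpM2r ?wplus_ge0// !indicE ler_nat.
have [/set_mem xr|//] := boolP (x \in cball 0 r).
by rewrite mem_set// /cball /= (le_trans xr).
Qed.

Let riemann_measurable tau k m : 0 < tau -> 0 < k -> tau + k * m%:R <= T ->
  measurable_fun setT (riemann tau k m) /\
  forall x, riemann tau k m x <= k * \sum_(0 <= j < m) (delta2 * (2 * B)).
Proof.
move=> tau0 k0 kT.
have sT j : (j < m)%N -> 0 < tau + j.+1%:R * k <= T.
  move=> jm; rewrite addr_gt0//=; last by rewrite mulr_gt0.
  by rewrite (le_trans _ kT)// lerD2l mulrC ler_wpM2l ?(ltW k0)// ler_nat.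
split.
  apply: measurable_funM => //.
  elim: m sT {kT} => [|m IH] sT.
    by under eq_fun do rewrite big_nil; exact: measurable_cst.
  under eq_fun do rewrite big_nat_recr//=.
  apply: measurable_funD; last by apply: measurable_Wplus; exact: sT.
  by apply: IH => j jm; apply: sT; exact: ltnW.
move=> x; rewrite ler_wpM2l ?(ltW k0)// [leLHS]big_nat [leRHS]big_nat.
by apply: ler_sum => j /andP[_ jm]; rewrite Wplus_bnd// sT.
Qed.

(** The pointwise inequality is integrated against [cutoff r]; translation
    invariance moves the second differences from [F] to the cutoff, where they
    are bounded above and [F] is nonnegative. *)
Lemma mass_step r tau t S eta : 0 < r -> 0 < tau -> tau < t <= T -> 0 < eta ->
  (forall s, 0 < s <= T -> mass s (3 * r) <= S) ->
  r ^+ 2 * mass t r <= 4 * r ^+ 2 * mass tau (2 * r) + 2 * N%:R * delta2 * T * S + eta.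
Proof.
move=> r0 tau0 taut eta0 HS; move: (taut) => /andP[tt tT].
have tauT : 0 < tau <= T by rewrite tau0 (le_trans (ltW tt)).
have t0T : 0 < t <= T by rewrite (lt_trans tau0).
pose psi := @cutoff R N r.
have bpsi : bounded_local psi by exact: bounded_local_cutoff.
have psi0 x : 0 <= psi x by exact: cutoff_ge0.
pose A := \int[mu]_x psi x.
have A0 : 0 <= A by apply: Rintegral_ge0 => x _; exact: psi0.
have [c c0 cA] : exists2 c, 0 < c & (c + c) * A <= eta.
  exists (eta / (2 * (A + 1))); first by rewrite divr_gt0// mulr_gt0// ltr_wpDl.
  rewrite (_ : _ * A = eta * (A / (A + 1))); last by field; rewrite gt_eqF// ltr_wpDl.
  by rewrite ler_piMr ?(ltW eta0)// ler_pdivrMr ?mul1r ?lerDl// ltr_wpDl.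
have [h [k [m [delta [/andP[h0 hr] k0 km delta0 HF]]]]] := riemann_pointwise r0 tau0 taut c0 c0.
pose F x := Num.max (riemann tau k m x - delta) 0.
have kT : tau + k * m%:R <= T by rewrite km addrC subrK.
have [mZ bZ] := riemann_measurable tau0 k0 kT.
have F0 x : 0 <= F x by rewrite le_max lexx orbT.
have FZ x : F x <= riemann tau k m x.
  by rewrite ge_max riemann_ge0 ?(ltW k0)// andbT gerBl ltW.
have mF : measurable_fun setT F.
  by apply: measurable_maxr => //; exact: measurable_funB.
have bF : exists M, forall x, `|F x| <= M.
  by exists (k * \sum_(0 <= j < m) (delta2 * (2 * B))) => x; rewrite ger0_norm// (le_trans (FZ x)).
have blF f : bounded_local f -> bounded_local (fun x => f x * F x) by move=> bf; exact: bounded_localM.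
have blFt f a : bounded_local f -> bounded_local (fun x => f x * F (x + a)).
  move=> bf; have := bounded_local_translate a (blF _ (bounded_local_translate (- a) bf)).
  by congr bounded_local; apply/funext => x; rewrite addrK.
have bpt a : bounded_local (fun x => psi (x + a)) by exact: bounded_local_translate.
(* [G i] and [H i] carry the second difference on [F] and on the cutoff. *)
pose G i x := psi x * F (x + h *: e_ i) + psi x * F (x - h *: e_ i) + - 2 * (psi x * F x).
pose H i x := psi (x - h *: e_ i) * F x + psi (x + h *: e_ i) * F x + - 2 * (psi x * F x).
have bG i : bounded_local (G i).
  by apply: bounded_localD; [apply: bounded_localD; exact: blFt|apply: bounded_localZ; exact: blF].
have bH i : bounded_local (H i).
  by apply: bounded_localD; [apply: bounded_localD; exact: blF|apply: bounded_localZ; exact: blF].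
have GH i : \int[mu]_x G i x = \int[mu]_x H i x.
  rewrite local_integralD; [|by apply: bounded_localD; exact: blFt|by apply: bounded_localZ; exact: blF].
  rewrite local_integralD; [|exact: blFt|exact: blFt].
  rewrite [RHS]local_integralD; [|by apply: bounded_localD; exact: blF|by apply: bounded_localZ; exact: blF].
  rewrite [X in _ = X + _]local_integralD; [|exact: blF|exact: blF].
  congr (_ + _ + _).
    rewrite -[RHS](local_integral_translate (h *: e_ i)); last exact: blF.
    by apply: eq_Rintegral => x _; rewrite addrK.
  rewrite -[RHS](local_integral_translate (- (h *: e_ i))); last exact: blF.
  by apply: eq_Rintegral => x _; rewrite subrK.
have pointwise x : psi x * wplus t x <=
    (c + c) * psi x + psi x * wplus tau x + h ^- 2 * \sum_i G i x.
  have -> : \sum_i G i x = psi x * \sum_i (F (x + h *: e_ i) + F (x - h *: e_ i) - F x *+ 2).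
    by rewrite mulr_sumr; apply: eq_bigr => i _; rewrite /G; ring.
  rewrite [h ^- 2 * _]mulrCA [(c + c) * _]mulrC -!mulrDr.
  have [xr|xr] := leP `|x| (2 * r); first by apply: ler_wpM2l => //; exact: HF.
  by rewrite /psi /cutoff max_r ?subr_le0 ?(ltW xr)// expr0n !mul0r.
have b1 : bounded_local (fun x => (c + c) * psi x + psi x * wplus tau x).
  by apply: bounded_localD; [exact: bounded_localZ|exact: bounded_local_wplus].
have bsG : bounded_local (fun x => \sum_i G i x) by exact: bounded_local_sum.
have bc := @bounded_local_cball R N.
have main : \int[mu]_x (psi x * wplus t x) <= (c + c) * A + \int[mu]_x (psi x * wplus tau x)
    + h ^- 2 * \sum_i \int[mu]_x H i x.
  have -> : \sum_i \int[mu]_x H i x = \int[mu]_x (\sum_i G i x).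
    by rewrite local_integral_sum//; apply: eq_bigr => i _; rewrite GH.
  rewrite -(local_integralZ (c + c) bpsi) -(local_integralZ (h ^- 2) bsG).
  rewrite -local_integralD; [|exact: bounded_localZ|exact: bounded_local_wplus].
  rewrite -local_integralD; [|exact: b1|exact: bounded_localZ].
  apply: local_integral_le => //; first exact: bounded_local_wplus.
  by apply: bounded_localD => //; exact: bounded_localZ.
pose Z3 := \int[mu]_x (\1_(cball 0 (3 * r)) x * F x).
have HZ i : \int[mu]_x H i x <= 2 * h ^+ 2 * Z3.
  rewrite -local_integralZ; last exact: blF.
  apply: local_integral_le => //; first by apply: bounded_localZ; exact: blF.
  move=> x; rewrite mulrA (_ : H i x = (cutoff r (x + h *: e_ i) + cutoff r (x - h *: e_ i)
    - cutoff r x *+ 2) * F x); last by rewrite /H /psi; ring.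
  by rewrite ler_wpM2r// cutoff_second_difference// h0.
have Z3le : Z3 <= delta2 * T * S.
  have sT (j : 'I_m) : 0 < tau + j.+1%:R * k <= T.
    rewrite addr_gt0//=; last by rewrite mulr_gt0.
    by rewrite (le_trans _ kT)// lerD2l mulrC ler_wpM2l ?(ltW k0)// ler_nat.
  pose V (j : 'I_m) x := \1_(cball 0 (3 * r)) x * Wplus (tau + j.+1%:R * k) x.
  have bV j : bounded_local (V j) by apply: bounded_local_Wplus.
  apply: (@le_trans _ _ (\int[mu]_x (k * \sum_(j < m) V j x))).
    apply: local_integral_le; [exact: blF|by apply: bounded_localZ; exact: bounded_local_sum|].
    move=> x; rewrite -mulr_sumr mulrCA ler_wpM2l//.
    by apply: le_trans (FZ x) _; rewrite /riemann big_mkord.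
  rewrite local_integralZ; last exact: bounded_local_sum.
  rewrite local_integral_sum//.
  apply: (@le_trans _ _ (k * \sum_(j < m) delta2 * S)).
    rewrite ler_wpM2l ?(ltW k0)//; apply: ler_sum => j _.
    by apply: le_trans (integral_Wplus_le _ (sT j)) _; rewrite ler_wpM2l// HS.
  rewrite sumr_const card_ord -[in leLHS]mulr_natr [k * _]mulrCA km [leRHS]mulrAC.
  have S0 : 0 <= S by rewrite (le_trans (mass_ge0 t (3 * r)))// HS.
  rewrite ler_wpM2l ?mulr_ge0//.
  by rewrite (le_trans _ tT)// gerBl ltW.
have S0 : 0 <= S by rewrite (le_trans (mass_ge0 t (3 * r)))// HS.
have lhs : r ^+ 2 * mass t r <= \int[mu]_x (psi x * wplus t x).
  rewrite -local_integralZ; last exact: bounded_local_wplus.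
  apply: local_integral_le; [by apply: bounded_localZ; exact: bounded_local_wplus|exact: bounded_local_wplus|].
  by move=> x; rewrite mulrA ler_wpM2r ?wplus_ge0// cutoff_ge.
have rhs : \int[mu]_x (psi x * wplus tau x) <= 4 * r ^+ 2 * mass tau (2 * r).
  rewrite -local_integralZ; last exact: bounded_local_wplus.
  apply: local_integral_le; [exact: bounded_local_wplus|by apply: bounded_localZ; exact: bounded_local_wplus|].
  by move=> x; rewrite mulrA ler_wpM2r ?wplus_ge0// cutoff_le.
have sumH : h ^- 2 * \sum_i \int[mu]_x H i x <= 2 * N%:R * delta2 * T * S.
  rewrite mulrC ler_pdivrMr ?exprn_gt0//.
  apply: (@le_trans _ _ (\sum_(i < N) 2 * h ^+ 2 * (delta2 * T * S))).
    apply: ler_sum => i _; apply: le_trans (HZ i) _.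
    by rewrite ler_wpM2l// mulr_ge0// sqr_ge0.
  by rewrite sumr_const card_ord -[leLHS]mulr_natr le_eqVlt; apply/orP; left; apply/eqP; ring.
apply: le_trans lhs _; apply: le_trans main _.
rewrite [leRHS]addrC addrA; apply: lerD; last exact: sumH.
by apply: lerD; [exact: cA|exact: rhs].
Qed.

(** ** Initial values *)

Variables u0 v0 : 'rV[R]_N -> R.
Hypotheses (hu0 : Linfty mu Omega u0) (hv0 : Linfty mu Omega v0)
  (hu_init : cvg_L1loc_at0 Omega u u0) (hv_init : cvg_L1loc_at0 Omega v v0)
  (huv0 : {ae mu, forall x, Omega x -> u0 x <= v0 x}).

Let measurable_slice (g : 'rV[R]_N * R -> R) s : {within Q, continuous g} -> 0 < s <= T ->
  measurable_fun setT ((fun x => g (x, s)) \_ Omega : 'rV[R]_N -> R).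
Proof.
move=> cg sT.
have cNg : {within Q, continuous (fun z => - g z)}.
  apply/subspace_continuousP => z Qz.
  have FF : Filter (within Q (nbhs z)) by exact: within_filter.
  move/subspace_continuousP : cg => /(_ _ Qz) cg.
  exact: cvgN cg.
rewrite (_ : _ \_ _ = (fun x => ((fun x => Num.max (g (x, s)) 0) \_ Omega) x
   - ((fun x => Num.max (- g (x, s)) 0) \_ Omega) x)).
  by apply: measurable_funB; [exact: measurable_pos_part|exact: (measurable_pos_part cNg)].
apply/funext => x; rewrite !patchE; case: ifP => _; last by rewrite subrr.
have [g0|g0] := leP 0 (g (x, s)).
  by rewrite max_r ?subr0// oppr_le0.
by rewrite max_l ?oppr_ge0 ?(ltW g0)// sub0r opprK.
Qed.

Let measurable_L1_integrand (g : 'rV[R]_N * R -> R) g0 s (K : set 'rV[R]_N) :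
  {within Q, continuous g} -> Linfty mu Omega g0 -> 0 < s <= T ->
  measurable K -> K `<=` Omega ->
  measurable_fun K (fun x => `|(g (x, s) - g0 x)%:E|%E).
Proof.
move=> cg /sub_Lfun_mfun; rewrite inE /= => mg0 sT mK KO.
apply: (@eq_measurable_fun _ _ _ _ _ (fun x => `|(((fun x => g (x, s)) \_ Omega) x - (g0 \_ Omega) x)%:E|%E)).
  by move=> x /set_mem /KO Ox; rewrite !patchE mem_set.
apply: measurable_funTS; apply: measurableT_comp => //.
by apply/measurable_EFinP; apply: measurable_funB => //; exact: measurable_slice.
Qed.

Let L1_small (g : 'rV[R]_N * R -> R) g0 (K : set 'rV[R]_N) e :
  cvg_L1loc_at0 Omega g g0 -> compact K -> K `<=` Omega -> 0 < e ->
  exists2 d, 0 < d & forall s, 0 < s < d ->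
    (\int[mu]_(x in K) `|(g (x, s) - g0 x)%:E| < e%:E)%E.
Proof.
move=> hg cK KO e0.
have /(hg K cK KO) : nbhs (0%E : \bar R) [set y | (y < e%:E)%E].
  by apply: open_nbhs_nbhs; split; [exact: open_ereal_lt_ereal|rewrite /= lte_fin].
move=> /nbhs_ballP[d /= d0 Hd]; exists d => // s /andP[s0 sd].
apply: (Hd s) => //=.
by rewrite /ball /= sub0r normrN gtr0_norm.
Qed.

(** On a large compact subset of [Omega], [wplus s] is bounded almost everywhere by
    the distances of [u] and [v] to their initial values, which are ordered; the
    remainder of a bounded part of [Omega] has small measure, and there the bound
    on [u] and [v] suffices. *)
Lemma mass_initial r e : 0 < e ->
  exists2 d, 0 < d & forall s, 0 < s < d -> s <= T -> mass s r <= e.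
Proof.
move=> e0.
pose U := Omega `&` ball 0 (r + 1).
have oU : open U by apply: openI => //; exact: ball_open.
have UB : U `<=` cball 0 (r + 1).
  by move=> x [_]; rewrite mx_norm_ball /ball_ /cball /= distrC => /ltW.
have mU : measurable U by exact: open_measurable_rV.
have Uoo : (mu U < +oo)%E.
  apply: le_lt_trans (lebesgue_cball_lty (r + 1)).
  by apply: le_measure; rewrite ?inE//; exact: measurable_cball.
have B1 : 0 < B + 1 by rewrite ltr_wpDl.
have e1 : 0 < e / (4 * (B + 1)) by rewrite divr_gt0// mulr_gt0.
have [K [cK mK KU muK]] := open_inner_regular oU Uoo e1.
have KO : K `<=` Omega by move=> x /KU[].
have e4 : 0 < e / 4 by rewrite divr_gt0.
have [d1 d10 Hd1] := L1_small hu_init cK KO e4.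
have [d2 d20 Hd2] := L1_small hv_init cK KO e4.
exists (Num.min d1 d2); first by rewrite lt_min d10.
move=> s /andP[s0 +] sT'; rewrite lt_min => /andP[sd1 sd2].
have sT : 0 < s <= T by rewrite s0.
have mUK : measurable (U `\` K) by exact: measurableD.
have bK : bounded_local \1_K by apply: (@bounded_local_indic _ _ _ (r + 1)) => // x /KU /UB.
have bUK : bounded_local \1_(U `\` K).
  by apply: (@bounded_local_indic _ _ _ (r + 1)) => // x [/UB].
have split_le : mass s r <= 2 * B * \int[mu]_x (\1_(U `\` K) x) + \int[mu]_x (\1_K x * wplus s x).
  rewrite -local_integralZ// -local_integralD; [|exact: bounded_localZ|exact: bounded_local_wplus].
  apply: local_integral_le.
  - by apply: bounded_local_wplus => //; exact: bounded_local_cball.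
  - by apply: bounded_localD; [exact: bounded_localZ|exact: bounded_local_wplus].
  move=> x; have [xK|xK] := boolP (x \in K).
    rewrite !indicE xK mul1r -[leLHS]add0r lerD ?mulr_ge0//.
    by rewrite ler_piMl ?wplus_ge0// lern1 leq_b1.
  have [xU|xU] := boolP (x \in U).
    rewrite !indicE (negbTE xK) mul0r addr0.
    rewrite (_ : x \in U `\` K); last first.
      by apply: mem_set; split; [exact: set_mem|move=> /mem_set; rewrite (negbTE xK)].
    rewrite mulr1 (le_trans _ (wplus_le x sT))// ler_piMl ?wplus_ge0// lern1 leq_b1.
    by [].
  rewrite (_ : \1_(cball 0 r) x * wplus s x = 0).
    by rewrite addr_ge0 ?mulr_ge0// ?wplus_ge0.
  have [xO|xO] := boolP (x \in Omega); last by rewrite /wplus patchE (negbTE xO) mulr0.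
  rewrite indicE memNset ?mul0r// /cball /= subr0 => xr.
  move: xU; rewrite mem_set//; split; first exact: set_mem.
  by rewrite mx_norm_ball /ball_ /= sub0r normrN ltr_pwDr.
have UK_le : \int[mu]_x (\1_(U `\` K) x) <= e / (4 * (B + 1)).
  rewrite /Rintegral integral_indic// setIT -lee_fin fineK//.
  rewrite ge0_fin_numE//; apply: le_lt_trans muK _; exact: ltry.
have K_le : \int[mu]_x (\1_K x * wplus s x) <= e / 2.
  rewrite -lee_fin /Rintegral fineK; last first.
    by apply: integrable_fin_num => //; exact: bounded_local_integrable (bounded_local_wplus sT bK).
  rewrite (_ : (\int[mu]_x (\1_K x * wplus s x)%:E)%E = (\int[mu]_(x in K) (wplus s x)%:E)%E); last first.
    rewrite [RHS]integral_mkcond; apply: eq_integral => x _.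
    by rewrite patchE indicE; case: ifP => _; rewrite ?mul1r ?mul0r.
  have mu1 := measurable_L1_integrand (continuous_subspaceW Q_sub_Qbar hu_cont) hu0 sT mK KO.
  have mv1 := measurable_L1_integrand (continuous_subspaceW Q_sub_Qbar hv_cont) hv0 sT mK KO.
  apply: (@le_trans _ _ (\int[mu]_(x in K) (`|(u (x, s) - u0 x)%:E| + `|(v (x, s) - v0 x)%:E|))%E).
    apply: ae_ge0_le_integral => //.
    - by move=> x _; rewrite lee_fin wplus_ge0.
    - by apply/measurable_EFinP; apply: measurable_funTS; exact: measurable_wplus.
    - by move=> x _; rewrite adde_ge0.
    - exact: emeasurable_funD.
    apply: filterS huv0 => x Huv Kx.
    have Ox := KO _ Kx; have := Huv Ox.
    rewrite lee_fin wplusE// => uv0.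
    have := ler_norm (u (x, s) - u0 x); have := ler_norm (- (v (x, s) - v0 x)); rewrite normrN.
    rewrite ge_max addr_ge0// andbT; lra.
  rewrite ge0_integralD//.
  rewrite (_ : e / 2 = e / 4 + e / 4); last by field.
  have s01 : 0 < s < d1 by rewrite s0.
  have s02 : 0 < s < d2 by rewrite s0.
  by rewrite EFinD leeD// ltW// ?Hd1 ?Hd2.
have B2 : 0 <= 2 * B by rewrite mulr_ge0.
apply: (le_trans split_le); rewrite [leRHS](splitr e); apply: lerD => //.
apply: (le_trans (ler_wpM2l B2 UK_le)).
have -> : 2 * B * (e / (4 * (B + 1))) = e / 2 * (B / (B + 1)) by field; rewrite gt_eqF.
by rewrite ler_piMr ?divr_ge0 ?(ltW e0)// ler_pdivrMr ?mul1r ?lerDl.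
Qed.

(** ** Iteration in the radius *)

Lemma mass_le_wider r t S : 0 < r -> 0 < t <= T ->
  (forall s, 0 < s <= T -> mass s (3 * r) <= S) ->
  r ^+ 2 * mass t r <= 2 * N%:R * delta2 * T * S.
Proof.
move=> r0 /andP[t0 tT] HS; apply/ler_addgt0Pr => e e0.
have r20 : 0 < 4 * r ^+ 2 by rewrite mulr_gt0// exprn_gt0.
have e1 : 0 < e / 2 / (4 * r ^+ 2) by rewrite !divr_gt0.
have [d d0 Hd] := mass_initial (2 * r) e1.
pose tau := Num.min d t / 2.
have m0 : 0 < Num.min d t by rewrite lt_min d0.
have tau0 : 0 < tau by rewrite divr_gt0.
have tm : tau < Num.min d t by rewrite /tau; lra.
move: (tm); rewrite lt_min => /andP[td tt].
have tt' : tau < t <= T by rewrite tt.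
have e2 : 0 < e / 2 by rewrite divr_gt0.
have := mass_step r0 tau0 tt' e2 HS.
have Hm : mass tau (2 * r) <= e / 2 / (4 * r ^+ 2).
  by apply: Hd; rewrite ?tau0// (le_trans (ltW tt)).
have := ler_wpM2l (ltW r20) Hm.
rewrite [X in _ <= X]mulrC divfK ?gt_eqF//; lra.
Qed.

(** Each step gains a factor [r^2], starting from the bound of the mass by the
    volume. *)
Lemma mass_decay p : exists2 C, 0 <= C & forall r t, 1 <= r -> 0 < t <= T ->
  mass t r * r ^+ (2 * p) <= C * r ^+ N.
Proof.
elim: p => [|p [C C0 IH]].
  exists (2 * B * 4 ^+ N); first by rewrite !mulr_ge0.
  move=> r t r1 tT; rewrite muln0 expr0 mulr1.
  by have := mass_le_volume (lt_le_trans ltr01 r1) tT; rewrite exprMn mulrA.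
have [T0|T0] := leP T 0.
  by exists 0 => // r t _ /andP[t0 tT]; move: (lt_le_trans t0 (le_trans tT T0)); rewrite ltxx.
pose C1 := 2 * N%:R * delta2 * T.
have C10 : 0 <= C1 by rewrite /C1 !mulr_ge0 ?(ltW T0).
exists (C1 * (C * 3 ^+ N)); first by rewrite mulr_ge0// mulr_ge0.
move=> r t r1 tT.
have r0 : 0 < r by rewrite (lt_le_trans ltr01).
have rp : 0 < r ^+ (2 * p) by rewrite exprn_gt0.
have HS s : 0 < s <= T -> mass s (3 * r) <= C * 3 ^+ N * r ^+ N / r ^+ (2 * p).
  move=> sT; rewrite ler_pdivlMr//.
  have r31 : 1 <= 3 * r by lra.
  have := IH _ _ r31 sT; rewrite [(3 * r) ^+ N]exprMn [C * _]mulrA; apply: le_trans.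
  rewrite ler_wpM2l ?mass_ge0//; apply: lerXn2r; rewrite ?nnegrE; lra.
have := mass_le_wider r0 tT HS; rewrite -/C1 => H.
rewrite mulnS exprD mulrA [mass t r * _]mulrC -(ler_pdivlMr _ _ rp).
by apply: le_trans H _; rewrite !mulrA.
Qed.

(** [mass_decay] with exponent [N] bounds the mass by a multiple of [1 / R0^N] on
    every ball of radius [R0] containing the given one. *)
Lemma mass_eq0 r t : 0 < t <= T -> mass t r = 0.
Proof.
move=> tT; apply/eqP; rewrite eq_le mass_ge0 andbT.
have [C C0 HC] := mass_decay N.
apply/ler_addgt0Pr => e e0; rewrite add0r.
pose R0 := Num.max (Num.max r 1) (C / e).
have R1 : 1 <= R0 by rewrite !le_max lexx orbT.
have R00 : 0 < R0 by rewrite (lt_le_trans ltr01).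
have rR : r <= R0 by rewrite !le_max lexx.
have CR : C / e <= R0 by rewrite !le_max lexx !orbT.
apply: le_trans (mass_monotone rR tT) _.
have := HC R0 t R1 tT; rewrite mul2n -addnn exprD mulrA ler_pM2r ?exprn_gt0// => H.
rewrite -(ler_pM2r R00) (le_trans (y := C))//; last by rewrite mulrC -ler_pdivrMr.
apply: le_trans H; rewrite ler_wpM2l ?mass_ge0//.
by rewrite -(prednK N_gt0) exprS ler_peMr ?(ltW R00)// exprn_ege1.
Qed.

Lemma comparison_inside z : Q z -> u z <= v z.
Proof.
case: z => x t Qz; rewrite leNgt; apply/negP => vu.
have tT : 0 < t <= T by case: Qz.
have w0 : 0 < w (x, t) by rewrite subr_gt0.
have w20 : 0 < w (x, t) / 2 by rewrite divr_gt0.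
have cw : {within Q, continuous (fun z => w z)}.
  exact: continuous_subspaceW Q_sub_Qbar within_continuous_w.
have [d1 d10 Hd1] := within_continuous_ball cw Qz w20.
have /nbhs_ballP[d2 /= d20 Hd2] : nbhs x Omega by case: Qz => Ox _; exact: open_nbhs_nbhs.
pose d := Num.min d1 d2.
have d0 : 0 < d by rewrite lt_min d10.
have dd1 : d <= d1 by rewrite ge_min lexx.
have dd2 : d <= d2 by rewrite ge_min lexx orbT.
pose r := `|x| + d.
have br : ball x d `<=` cball 0 r.
  move=> y; rewrite mx_norm_ball /ball_ /cball /= subr0 => xy.
  by rewrite -[y](subKr x) (le_trans (ler_normB _ _))// lerD2l ltW.
have mb : measurable (ball x d) by apply: open_measurable_rV; exact: ball_open.
have bb : bounded_local \1_(ball x d) by exact: bounded_local_indic mb br.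
have le1 : w (x, t) / 2 * \int[mu]_y (\1_(ball x d) y) <= mass t r.
  rewrite -local_integralZ//; apply: local_integral_le.
  - exact: bounded_localZ.
  - by apply: bounded_local_wplus => //; exact: bounded_local_cball.
  move=> y; have [yb|yb] := boolP (y \in (ball x d : set 'rV[R]_N)); last first.
    by rewrite indicE (negbTE yb) mulr0 mulr_ge0// wplus_ge0.
  have {}yb := set_mem yb.
  rewrite !indicE !mem_set//; last exact: br.
  have Oy : Omega y by apply: Hd2; exact: le_ball yb.
  rewrite mulr1 mul1r wplusE// le_max; apply/orP; left.
  have Qy : Q (y, t) by split => //; case: Qz.
  have := Hd1 (y, t) Qy; rewrite ltr_norml => H.
  have /H/andP[] : ball (x, t) d1 (y, t) by split => /=; [exact: le_ball yb|exact: ballxx].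
  by rewrite /=; lra.
move: le1; rewrite mass_eq0//; apply/negP; rewrite -ltNge mulr_gt0//.
rewrite /Rintegral integral_indic// setIT fine_gt0// lebesgue_ball_gt0//=.
apply: le_lt_trans (lebesgue_cball_lty r).
by apply: le_measure; rewrite ?inE//; exact: measurable_cball.
Qed.

End comparison.

Unset Implicit Arguments.
Set Strict Implicit.
Set Printing Implicit Defensive.

Theorem theoremA1 (R : realType) (N : nat) (hN : (2 <= N)%N)
    (phi : R -> R) (delta1 delta2 : R)
    (hphi : C2 phi) (hphi0 : phi 0 = 0) (hdelta1 : 0 < delta1)
    (hphi' : forall s, delta1 <= derive1 phi s <= delta2)
    (T : R) (hT : 0 < T)
    (Omega : set 'rV[R]_N) (hOmega : is_domain Omega)
    (u v : 'rV[R]_N * R -> R)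
    (hu : C21 Omega T u) (hv : C21 Omega T v)
    (hu_bnd : Linfty (lebesgue_rV N \x lebesgue_measure)%E (Omega `*` `]0, T]) u)
    (hv_bnd : Linfty (lebesgue_rV N \x lebesgue_measure)%E (Omega `*` `]0, T]) v)
    (hu_cont : {within closure Omega `*` `]0, T], continuous u})
    (hv_cont : {within closure Omega `*` `]0, T], continuous v})
    (hpde : forall z, (Omega `*` `]0, T]) z ->
       dt T u z - laplacian (phi \o u) z <= dt T v z - laplacian (phi \o v) z)
    (hbdry : forall z, (boundary Omega `*` `]0, T]) z -> u z <= v z)
    (u0 v0 : 'rV[R]_N -> R)
    (hu0 : Linfty (lebesgue_rV N) Omega u0)
    (hv0 : Linfty (lebesgue_rV N) Omega v0)
    (hu_init : cvg_L1loc_at0 Omega u u0)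
    (hv_init : cvg_L1loc_at0 Omega v v0)
    (huv0 : {ae lebesgue_rV N, forall x, Omega x -> u0 x <= v0 x}) :
  forall z, (Omega `*` `]0, T]) z -> u z <= v z.
Proof.
have [_ _ oOmega] := hOmega.
have N_gt0 : (0 < N)%N := ltnW hN.
have [cu _ _ _ _] := hu; have [cv _ _ _ _] := hv.
have [Bu Bu0 HBu] := Linfty_bounded oOmega cu hu_bnd.
have [Bv Bv0 HBv] := Linfty_bounded oOmega cv hv_bnd.
have B_ge0 : 0 <= Num.max Bu Bv by rewrite le_max Bu0.
have hB z : (Omega `*` `]0, T]) z ->
    `|u z| <= Num.max Bu Bv /\ `|v z| <= Num.max Bu Bv.
  by move=> Qz; rewrite !le_max HBu// HBv// orbT.
exact: (comparison_inside hphi hdelta1 hphi' oOmega hu hv hu_cont hv_cont hpde hbdry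
  N_gt0 B_ge0 hB hu0 hv0 hu_init hv_init huv0).
Qed.
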